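(* Let $\mathcal{G}=(V,E)$ be a finite connected undirected graph with edge weights $\beta_{ij}=\beta_{ji}>0$, $(i\sim j)\in E$. Let $x,y\in V$ be two different vertices and let $\pi_i\ge 0$, $i\in V$, be fixed numbers with $\pi_x,\pi_y>0$. For $\epsilon>0$ set $\boldsymbol{\varepsilon}=(\varepsilon_i)_{i\in V}=(\pi_i\epsilon)_{i\in V}$. With the measures $\mu^{\boldsymbol{\varepsilon}}$, $\mu^{\varepsilon_x\delta_x}$, $\mu^{\varepsilon_y\delta_y}$, the Green's function $G^{\boldsymbol{\varepsilon}}_{xy}$ and the random variables $\mathcal{O}^\pi_{xy}$, $\mathcal{O}^\pi_{yx}$ defined in the context, one has $$0<\lim_{\epsilon\downarrow 0}\epsilon\, E_{\mu^{\boldsymbol{\varepsilon}}}[G_{xy}^{\boldsymbol{\varepsilon}}]\le\lim_{\epsilon\downarrow 0}\Big(E_{\mu^{\varepsilon_x\delta_x}}\big[\mathcal{O}_{xy}^\pi\big]+E_{\mu^{\varepsilon_y\delta_y}}\big[\mathcal{O}_{yx}^\pi\big]\Big)<\infty.$$ In particular, the two limits exist.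
   Context: Extended graph: add to $\mathcal{G}=(V,E)$ an extra vertex $\rho$ and an edge $i\sim\rho$ for every $i\in V$: $\mathcal{G}_\rho=(V_\rho,E_\rho)$, $V_\rho=V\cup\{\rho\}$, $E_\rho=E\cup\{(i\sim\rho):i\in V\}$. For a family $\boldsymbol{\varepsilon}=(\varepsilon_i)_{i\in V}$ with $\varepsilon_i\ge0$ and at least one $\varepsilon_i>0$ (the pinning), the edge $i\sim\rho$ carries the weight $\beta_{i\rho}:=\varepsilon_i$. $\mathcal{T}$ is the set of spanning trees of $\mathcal{G}_\rho$; a tree is identified with its edge set. For $t,s\in\mathbb{R}^V$ put $t_\rho:=0$, $s_\rho:=0$ and, for $i,j\in V_\rho$, $B_{ij}(t,s):=\cosh(t_i-t_j)+\frac12(s_i-s_j)^2e^{t_i+t_j}$. The measure $\mu^{\boldsymbol{\varepsilon}}$ on $\mathbb{R}^V\times\mathbb{R}^V\times\mathcal{T}$ is $$\mu^{\boldsymbol{\varepsilon}}(dt\,ds\,dT):=\prod_{j\in V}\frac{dt_j\,ds_j\,e^{-t_j}}{2\pi}\,dT\prod_{(i\sim j)\in E_\rho}e^{-\beta_{ij}(B_{ij}(t,s)-1)}\prod_{(i\sim j)\in T}\beta_{ij}e^{t_i+t_j},$$ with $dt_j,ds_j$ Lebesgue measure on $\mathbb{R}$ and $dT$ counting measure on $\mathcal{T}$ (in $1/(2\pi)$, $\pi$ is the usual constant). It is known that $\mu^{\boldsymbol{\varepsilon}}$ is a probability measure; $E_{\mu^{\boldsymbol{\varepsilon}}}$ is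 its expectation. The symbols $t,s,T$ also denote the canonical projections. For $z\in V$, $\varepsilon_z\delta_z\in\mathbb{R}^V$ is the vector with coordinate $\varepsilon_z$ at $z$ and $0$ elsewhere, and $\mu^{\varepsilon_z\delta_z}$ is the probability measure on $\mathbb{R}^V\times\mathbb{R}^V\times\mathcal{T}$ given by $\prod_{j\in V}\frac{dt_j\,ds_j\,e^{-t_j}}{2\pi}\,dT\prod_{(i\sim j)\in E_\rho}e^{-\beta_{ij}(B_{ij}(t,s)-1)}\prod_{(i\sim j)\in T}\beta_{ij}e^{t_i+t_j}$ with the weights $\beta_{z\rho}:=\varepsilon_z$ and $\beta_{i\rho}:=0$ for $i\in V\setminus\{z\}$, i.e. with pinning $\varepsilon_z\delta_z$ in place of $\boldsymbol{\varepsilon}$ (pinning at one point). The matrix $A(t)\in\mathbb{R}^{V\times V}$ has entries $A(t)_{ij}=-\beta_{ij}e^{t_i+t_j}$ if $(i\sim j)\in E$, $A(t)_{jj}=\sum_{k\in V:(k\sim j)\in E}\beta_{kj}e^{t_k+t_j}$, and $0$ otherwise. $\hat{\boldsymbol{\varepsilon}}(t):=\operatorname{diag}(\varepsilon_ie^{t_i},\,i\in V)$. The Green's function is $G_{xy}^{\boldsymbol{\varepsilon}}:=e^{t_x+t_y}\big((A(t)+\hat{\boldsymbol{\varepsilon}}(t))^{-1}\big)_{xy}$. Write $x\stackrel{T}{\leftrightarrow}y$ if $x$ and $y$ are connected in the spanning tree $T$ through a path which does not use $\rho$. Define $$\mathcal{O}_{xy}^\pi:=\frac{e^{t_x+t_y}}{\pi_xe^{t_x}+\pi_ye^{t_y}}\,1_{\{(x\sim\rho)\in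 T\text{ and }x\stackrel{T}{\leftrightarrow}y\}},$$ and $\mathcal{O}_{yx}^\pi$ by interchanging $x$ and $y$. *)

(* Defs.v *)
From HB Require Import structures.
From mathcomp Require Import all_boot all_order all_algebra.
From mathcomp Require Import all_classical all_reals all_analysis.
From mathcomp Require Import measurable_realfun.
Set Implicit Arguments.
Unset Strict Implicit.
Unset Printing Implicit Defensive.
Import Order.TTheory GRing.Theory Num.Theory.
Import numFieldNormedType.Exports.
Local Open Scope classical_set_scope.
Local Open Scope ring_scope.

(* Simple graphs are symmetric irreflexive relations; undirected edges are
   two-element sets of vertices. *)
Section graphs.
Variable W : finType.

Definition edges (r : rel W) : {set {set W}} :=
  [set [set p.1; p.2]%SET | p in [pred p : W * W | r p.1 p.2]]%SET.

Definition adj (S : {set {set W}}) : rel W := fun i j => [set i; j]%SET \in S.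

Definition connected_graph (r : rel W) : bool :=
  [forall i, forall j, connect r i j].

(* cycles have at least three pairwise distinct vertices *)
Definition acyclic_graph (r : rel W) : Prop :=
  forall c : seq W, ucycle r c -> (size c <= 2)%N.

Definition is_spanning_tree (r : rel W) (T : {set {set W}}) : bool :=
  [&& T \subset edges r, connected_graph (adj T) & `[< acyclic_graph (adj T) >]].

(* Product of F i j over the undirected edges i ~ j in S; each edge is read
   once, with its ends ordered by [enum_rank].  F is meant to be symmetric on
   the edges in S. *)
Definition edge_prod (R : realType) (S : {set {set W}}) (F : W -> W -> R) : R :=
  \prod_(p : W * W | (enum_rank p.1 < enum_rank p.2)%N
                     && ([set p.1; p.2]%SET \in S)) F p.1 p.2.

End graphs.

(* The extra vertex rho is [None : option V]. *)
Definition ext_rel (V : finType) (e : rel V) : rel (option V) := fun i j =>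
  match i, j with
  | Some a, Some b => e a b
  | None, None => false
  | _, _ => true
  end.

Definition spanning_tree (V : finType) (e : rel V) : predArgType :=
  {T : {set {set (option V)}} | is_spanning_tree (ext_rel e) T}.

HB.instance Definition _ (V : finType) (e : rel V) :=
  Finite.on (spanning_tree e).

Section star.
Variables (V : finType) (e : rel V).

Let star : {set {set (option V)}} :=
  [set [set Some v; None]%SET | v : V]%SET.

Let adj_star i j : adj star i j = (i == None) (+) (j == None).
Proof.
apply/imsetP/idP => [[v _ E]|].
  have : None \in [set i; j]%SET by rewrite E !inE eqxx orbT.
  have : Some v \in [set i; j]%SET by rewrite E !inE eqxx.
  have := set21 i j; have := set22 i j; rewrite {1 2}E !inE.
  by case: i {E} => [a|]; case: j => [b|].
case: i => [a|]; case: j => [b|] //= _; first by exists a; rewrite ?inE.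
by exists b; rewrite ?inE// finset.setUC.
Qed.

Lemma star_spanning_tree : is_spanning_tree (ext_rel e) star.
Proof.
apply/and3P; split.
- apply/fintype.subsetP => _ /imsetP[v _ ->].
  by apply/imsetP; exists (Some v, None).
- have c1 v : connect (adj star) (Some v) None by apply: connect1; rewrite adj_star.
  have c2 v : connect (adj star) None (Some v) by apply: connect1; rewrite adj_star.
  apply/forallP => -[a|]; apply/forallP => -[b|] //.
  exact: connect_trans (c1 a) (c2 b).
- apply/asboolP => -[|a [|b [|d c]]] //; rewrite /ucycle /ucycleb /= => /andP[].
  rewrite !adj_star !inE !negb_or.
  case: b => [b|] /=.
    by case: a => [a|] //=; case: d => [d|] //= _; rewrite andbF.
  case: d => [d|] /=; last by rewrite !andbF.
  case: a => [a|] //=; case: c => [|[f|] c] //=; rewrite ?adj_star//=.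
  by rewrite !inE/= !andbF.
Qed.

HB.instance Definition _ := isPointed.Build (spanning_tree e)
  (exist _ star star_spanning_tree).

HB.instance Definition _ := @isMeasurable.Build default_measure_display
  (spanning_tree e) discrete_measurable discrete_measurable0
  discrete_measurableC discrete_measurableU.

End star.

Section counting_trees.
Variables (R : realType) (V : finType) (e : rel V).
Local Open Scope ereal_scope.

Definition tree_counting : set (spanning_tree e) -> \bar R := counting.

HB.instance Definition _ := Measure.on tree_counting.

Let tree_counting_sigma_finite : sigma_finite setT tree_counting.
Proof.
exists (fun=> setT); first by rewrite bigcup_const.
by move=> _; split => //; rewrite /tree_counting /counting asboolT ?ltry//; exact: finite_finset.
Qed.

HB.instance Definition _ := Measure_isSigmaFinite.Build _ _ _ tree_counting
  tree_counting_sigma_finite.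

End counting_trees.

Section lebesgue_tuple.
Variable R : realType.
Local Open Scope ereal_scope.

Definition tuple_cons n (p : measurableTypeR R * n.-tuple (measurableTypeR R)) :
  n.+1.-tuple (measurableTypeR R) := [tuple of p.1 :: p.2].

(* n-dimensional Lebesgue measure, as an iterated product measure *)
Fixpoint lebesgue_tuple n : set (n.-tuple (measurableTypeR R)) -> \bar R :=
  match n with
  | 0 => dirac [tuple]
  | n'.+1 => pushforward (lebesgue_measure \x @lebesgue_tuple n') (@tuple_cons n')
  end.

Lemma measurable_tuple_cons n : measurable_fun setT (@tuple_cons n).
Proof. exact: measurable_cons. Qed.

Let lebesgue_tupleP n :
  [/\ @lebesgue_tuple n set0 = 0, forall A, 0 <= @lebesgue_tuple n A,
      semi_sigma_additive (@lebesgue_tuple n) &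
      sigma_finite setT (@lebesgue_tuple n)].
Proof.
elim: n => [|n [m0 mge0 madd msf]] /=.
  by split; [exact: measure0|move=> A; exact: measure_ge0|
             exact: measure_semi_sigma_additive|exact: sigma_finiteT].
set mn := @lebesgue_tuple n in m0 mge0 madd msf *.
pose mm := isMeasure.Build _ _ _ mn m0 mge0 madd.
pose mn' : {measure set _ -> \bar R} := HB.pack mn mm.
pose m : {sigma_finite_measure set _ -> \bar R} :=
  HB.pack mn mm (Measure_isSigmaFinite.Build _ _ _ mn' msf).
rewrite -[mn]/(m : set _ -> _); set f := @tuple_cons n.
have mf : measurable_fun setT f by exact: measurable_tuple_cons.
pose uncons (t : n.+1.-tuple (measurableTypeR R)) :
  measurableTypeR R * n.-tuple (measurableTypeR R) :=
  (thead t, [tuple of behead t]).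
have unconsK : cancel f uncons.
  by move=> [a t]; congr (_, _); exact/val_inj.
have mu : measurable_fun setT uncons.
  apply/measurable_fun_pairP; split; first exact: measurable_tnth.
  exact: measurable_behead.
pose m' : {measure set (measurableTypeR R * n.-tuple (measurableTypeR R))%type
    -> \bar R} := lebesgue_measure \x m.
(* the canonical sigma-finite instance of \x is shadowed by a later one for
   subprobabilities, so it is named explicitly *)
have [F UF Foo] : sigma_finite setT m'.
  by case: (lebesgue_integral_fubini.measure_function_Measure_isSigmaFinite__to__measure_function_isSigmaFinite
    lebesgue_measure m).
rewrite -[_ \x _]/(m' : set _ -> _).
split; [exact: measure0|move=> A; exact: measure_ge0|
  exact: measure_semi_sigma_additive|].
exists (fun k => uncons @^-1` F k).
  by rewrite -preimage_bigcup -UF preimage_setT.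
move=> k; have [mF Fk] := Foo k; split.
  by rewrite -[X in measurable X]setTI; exact: mu.
rewrite /pushforward -comp_preimage (_ : uncons \o f = id) ?preimage_id//.
by apply/funext => p /=; exact: unconsK.
Qed.

HB.instance Definition _ n := isMeasure.Build _ _ _ (@lebesgue_tuple n)
  (let: And4 h _ _ _ := lebesgue_tupleP n in h)
  (let: And4 _ h _ _ := lebesgue_tupleP n in h)
  (let: And4 _ _ h _ := lebesgue_tupleP n in h).

HB.instance Definition _ n := Measure_isSigmaFinite.Build _ _ _
  (@lebesgue_tuple n) (let: And4 _ _ _ h := lebesgue_tupleP n in h).

End lebesgue_tuple.

Section model.
Variables (R : realType) (V : finType) (e : rel V) (beta : V -> V -> R).

(* R^V, with coordinates indexed through [enum_rank] *)
Definition RV := #|V|.-tuple (measurableTypeR R).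

(* t_i for i in V_rho, where t_rho = 0 *)
Definition coord (t : RV) (i : option V) : R :=
  if i is Some a then tnth t (enum_rank a) else 0.

(* beta_ij for i ~ j in E_rho, with pinning eps *)
Definition weight (eps : V -> R) (i j : option V) : R :=
  match i, j with
  | Some a, Some b => beta a b
  | Some a, None => eps a
  | None, Some b => eps b
  | None, None => 0
  end.

Definition cosh (u : R) : R := (expR u + expR (- u)) / 2.

Definition B (t s : RV) (i j : option V) : R :=
  cosh (coord t i - coord t j) +
  (coord s i - coord s j) ^+ 2 * expR (coord t i + coord t j) / 2.

Definition config := (RV * RV * spanning_tree e)%type.

Definition density (eps : V -> R) (w : config) : R :=
  let t := w.1.1 in let s := w.1.2 in let T := val w.2 in
  (\prod_(j : V) (expR (- coord t (Some j)) / (2 * pi))) *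
  edge_prod (edges (ext_rel e))
    (fun i j => expR (- (weight eps i j * (B t s i j - 1)))) *
  edge_prod T (fun i j => weight eps i j * expR (coord t i + coord t j)).

Definition ref_measure : set config -> \bar R :=
  ((@lebesgue_tuple R #|V| \x @lebesgue_tuple R #|V|) \x tree_counting R (e := e))%E.

HB.instance Definition _ := Measure.on ref_measure.

Definition mu (eps : V -> R) : set config -> \bar R := fun A =>
  (\int[ref_measure]_(w in A) (density eps w)%:E)%E.

Definition expect (eps : V -> R) (f : config -> R) : \bar R :=
  (\int[mu eps]_w (f w)%:E)%E.

Definition laplacian (t : RV) : 'M[R]_#|V| := \matrix_(i, j)
  let a := enum_val i in let b := enum_val j in
  if a == b then
    \sum_(k | e k a) beta k a * expR (coord t (Some k) + coord t (Some a))
  else if e a b then - (beta a b * expR (coord t (Some a) + coord t (Some b)))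
  else 0.

Definition eps_hat (eps : V -> R) (t : RV) : 'M[R]_#|V| :=
  diag_mx (\row_i (eps (enum_val i) * expR (coord t (Some (enum_val i))))).

Definition green (eps : V -> R) (x y : V) (w : config) : R :=
  let t := w.1.1 in
  expR (coord t (Some x) + coord t (Some y)) *
  invmx (laplacian t + eps_hat eps t) (enum_rank x) (enum_rank y).

(* x and y are connected in T by a path avoiding rho *)
Definition tree_conn (T : spanning_tree e) (x y : V) : bool :=
  connect (fun a b : V => adj (val T) (Some a) (Some b)) x y.

Definition observable (p : V -> R) (x y : V) (w : config) : R :=
  let t := w.1.1 in let T := w.2 in
  expR (coord t (Some x) + coord t (Some y)) /
    (p x * expR (coord t (Some x)) + p y * expR (coord t (Some y))) *
  (adj (val T) (Some x) None && tree_conn T x y)%:R.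

Definition pin1 (a : R) (z : V) : V -> R := fun i => if i == z then a else 0.

Lemma density_ge0 (eps : V -> R) (w : config) : symmetric e ->
  (forall i j, e i j -> 0 < beta i j) -> (forall i, 0 <= eps i) ->
  0 <= density eps w.
Proof.
move=> esym b0 e0; rewrite /density /edge_prod; apply: mulr_ge0; first apply: mulr_ge0.
- by apply: prodr_ge0 => j _; rewrite divr_ge0 ?expR_ge0// mulr_ge0// pi_ge0.
- by apply: prodr_ge0 => p _; exact: expR_ge0.
apply: prodr_ge0 => -[i j] /= /andP[ij ijT]; rewrite mulr_ge0 ?expR_ge0//.
have /and3P[/fintype.subsetP/(_ _ ijT) + _ _] := valP w.2.
move=> /imsetP[[a b] /=]; rewrite inE/= => eab E.
have neq : i != j by apply: contraTneq ij => ->; rewrite ltnn.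
have : i \in [set a; b]%SET by rewrite -E set21.
have : j \in [set a; b]%SET by rewrite -E set22.
case: i j neq {ijT ij E} => [i|] [j|]//= neq; rewrite !inE => /orP[]/eqP ja /orP[]/eqP ia;
  move: neq; rewrite ja ia ?eqxx// => _; move: eab; rewrite -?ja -?ia /= => ?; apply: ltW; apply: b0 => //.
  by rewrite esym.
Qed.

Lemma measurable_coord i : measurable_fun [set: RV] (coord ^~ i : RV -> R).
Proof.
by case: i => [a|]; [exact: measurable_tnth|exact: measurable_cst].
Qed.

Lemma measurable_edge_prod d (T : measurableType d) (W : finType)
    (S : {set {set W}}) (F : W -> W -> T -> R) :
  (forall i j, measurable_fun setT (F i j)) ->
  measurable_fun setT (fun w => edge_prod S (fun i j => F i j w)).
Proof.
move=> mF; rewrite /edge_prod.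
rewrite (_ : (fun _ => _) = fun w => \prod_(p <- [seq p <- index_enum _ |
   (enum_rank p.1 < enum_rank p.2)%N && ([set p.1; p.2]%SET \in S)]) F p.1 p.2 w).
  by apply: measurable_prod => p _.
by apply/funext => w; rewrite big_filter.
Qed.

Lemma measurable_density eps : measurable_fun setT (density eps).
Proof.
pose g (T : spanning_tree e) (w : RV * RV) := density eps (w, T).
have mg T : measurable_fun setT (g T).
  have mt i : measurable_fun setT (fun w : RV * RV => coord w.1 i).
    by apply: measurableT_comp (measurable_coord i) _.
  have ms i : measurable_fun setT (fun w : RV * RV => coord w.2 i).
    by apply: measurableT_comp (measurable_coord i) _.
  have mB i j : measurable_fun setT (fun w : RV * RV => B w.1 w.2 i j).
    apply: measurable_funD.
      apply: measurable_funM => //; apply: measurable_funD.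
        by apply: measurableT_comp => //; exact: measurable_funB.
      apply: measurableT_comp => //; apply: measurable_funN.
      exact: measurable_funB.
    apply: measurable_funM => //; apply: measurable_funM.
      by apply: measurable_funX; exact: measurable_funB.
    by apply: measurableT_comp => //; exact: measurable_funD.
  rewrite /g /density /=.
  apply: measurable_funM; first apply: measurable_funM.
  - apply: measurable_prod => j _; apply: measurable_funM => //.
    by apply: measurableT_comp => //; exact: measurable_funN (mt (Some j)).
  - apply: measurable_edge_prod => i j; apply: measurableT_comp => //.
    apply: measurable_funN; apply: measurable_funM => //.
    exact: measurable_funB.
  - apply: measurable_edge_prod => i j; apply: measurable_funM => //.
    by apply: measurableT_comp => //; exact: measurable_funD.
move=> _ Y mY; rewrite setTI.
have -> : density eps @^-1` Y = \bigcup_(T in [set: spanning_tree e]) (g T @^-1` Y `*` [set T]).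
  apply/seteqP; split => [[w T] /= wY|[w T] [T' _ []]] /=.
    by exists T.
  by move=> ? ->.
apply: fin_bigcup_measurable => [|T _]; first exact: finite_finset.
apply: measurableX => //.
by rewrite -[X in measurable X]setTI; exact: mg.
Qed.

Lemma mu_is_measure eps : symmetric e -> (forall i j, e i j -> 0 < beta i j) ->
  (forall i, 0 <= eps i) ->
  exists m : {measure set config -> \bar R}, mu eps = m :> (set config -> \bar R).
Proof.
move=> esym b0 e0.
have dge0 w : (0 <= (density eps w)%:E)%E by rewrite lee_fin density_ge0.
have mu0 : mu eps set0 = 0 by rewrite /mu integral_set0.
have mu_ge0 A : (0 <= mu eps A)%E by apply: integral_ge0 => w _.
have mu_add : semi_sigma_additive (mu eps).
  apply: semi_sigma_additive_nng_induced => //.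
  by apply/measurable_EFinP; exact: measurable_density.
by exists (HB.pack_for {measure set config -> \bar R} (mu eps)
  (isMeasure.Build _ _ _ (mu eps) mu0 mu_ge0 mu_add)).
Qed.

End model.

(* Main.v *)
Require Import Defs.
From HB Require Import structures.
From mathcomp Require Import all_boot all_order all_algebra.
From mathcomp Require Import all_classical all_reals all_analysis.
From mathcomp Require Import measurable_realfun.
From mathcomp Require Import ring lra zify.
Set Implicit Arguments.
Unset Strict Implicit.
Unset Printing Implicit Defensive.
Import Order.TTheory GRing.Theory Num.Theory.
Import numFieldNormedType.Exports.
Local Open Scope classical_set_scope.
Local Open Scope ring_scope.

(** Fix the vertex x and let the pinning be q r, with r decreasing to 0.  The
    measure with weak pinning spreads out along the global shift of the field t:
    the relevant values of t are near - ln r, and this is what makes r times the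
    Green's function converge.  The proof follows the mass there by an explicit
    change of variables, [zoom].  The field t is written as its value at x plus
    the differences t_j - t_x, and s as its value a at x plus
    e^(- t_x) times the rescaled differences; finally t_x is translated by
    - ln r - ln (1 + a^2) - ln M, where M, called [mass], is the sum of
    q_i e^(t_i - t_x).

    In these coordinates the bonds of the graph do not see r at all.  A spanning
    tree of the extended graph with k edges at rho contributes, all powers of r
    taken together, r^(2 k - 2) times the quantity r f, where f is the observable
    ([zoom_density]); this count uses that such a tree has exactly #|V| edges.
    Hence only trees with a single edge at rho survive.  The translation by
    - ln (1 + a^2) - ln M turns the limit of the pinning factor into a function
    of the single remaining coordinate of t at x, and the remaining factor
    1 / (1 + a^2) is integrable in a.

    The only integral to be computed is that of 1 / (1 + u^2).  The hyperbolic
    cosines of the bonds beat every exponential of the differences of t, and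
    the quadratic form of the bonds beats every polynomial in the differences of
    s, so the integrand is bounded, uniformly in r, by a constant times a product
    of the functions 1 / (1 + u^2) over all coordinates
    ([integrand_dominated]).  Dominated convergence then gives [scaling_limit],
    which covers both sides of the inequality.

    For the Green's function, the matrix is that of an electric network whose
    conductances are of order r^(-2) compared with its grounding: the network
    becomes a single node and every entry of the inverse tends to the inverse of
    the total grounding ([network_inv_limit]).  For pinning at x alone, r times
    the observable of the tree is exactly constant in r.  The two limit
    integrands differ only in their tree sums and in the factors 1 / M^2 against
    1 / (pi_x (pi_x + pi_y e^(t_y - t_x))).  Moving the single edge at rho from
    w to x is an injection from the trees attached at w into those attached
    at x and keeps all inner edges, so the tree sum for general pinning is at most
    M times the inner tree sum.  Since M is at least
    pi_x + pi_y e^(t_y - t_x), the comparison holds pointwise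
    ([limit_comparison]).  The limit on the left is therefore bounded by the first
    of the two terms on the right alone. *)

Local Notation coord := Defs.coord.
Local Notation cosh := Defs.cosh.

(** * Integration against iterated Lebesgue measure *)

Section affine_line.
Variable R : realType.
Local Notation leb := (@lebesgue_measure R).
Local Open Scope ereal_scope.

Lemma ge0_integral_affine (c b : R) (f : R -> \bar R) : (0 < c)%R ->
  measurable_fun setT f -> (forall u, 0 <= f u) ->
  \int[leb]_u f u = c%:E * \int[leb]_u f (c * u + b)%R.
Proof.
move=> c0 mf f0.
have mphi : measurable_fun setT
  (fun u : measurableTypeR R => (c * u + b)%R : measurableTypeR R).
  by apply: measurable_funD => //; exact: measurable_funM.
rewrite -(ge0_integral_pushforward mphi leb measurableT) //.
have c0' : (0 <= c)%R by exact: ltW.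
rewrite -(ge0_integral_mscale _ measurableT (NngNum c0')) //.
apply: eq_measure_integral => //= A mA _.
apply: lebesgue_measure_unique => // _ [[l r] _ <-].
rewrite [RHS](_ : _ = c%:E * leb
    [set` Interval (BRight ((l - b) / c)%R) (BRight ((r - b) / c)%R)]); last first.
  congr (_ * leb _); apply/seteqP; split => u /=;
    rewrite !in_itv /= ltr_pdivrMr // ler_pdivlMr //.
    by move=> /andP[? ?]; apply/andP; split; lra.
  by move=> /andP[? ?]; apply/andP; split; lra.
rewrite !lebesgue_measure_itv /= !lte_fin ltr_pM2r ?invr_gt0 // ltrD2r.
case: ifPn => _; last by rewrite mule0.
by rewrite -!EFinB -EFinM; congr EFin; field; rewrite gt_eqF.
Qed.

End affine_line.

Section tuple_integral.
Variable R : realType.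
Local Notation tR := (measurableTypeR R).
Local Notation leb := (@lebesgue_measure R).
Local Notation lam n := (@lebesgue_tuple R n).

(** The coordinates of a tuple are peeled off one at a time in the definition
    of the measure, starting from the first; inserting at an arbitrary place i
    allows the coordinate of a chosen vertex to be singled out. *)
Definition insert_coord n (i : 'I_n.+1) (a : tR) (t : n.-tuple tR) :
    n.+1.-tuple tR :=
  [tuple if unlift i j is Some k then tnth t k else a | j < n.+1].

Lemma tnth_insert_coord n (i : 'I_n.+1) a (t : n.-tuple tR) :
  tnth (insert_coord i a t) i = a.
Proof. by rewrite tnth_mktuple unlift_none. Qed.

Lemma tnth_insert_coord_lift n (i : 'I_n.+1) a (t : n.-tuple tR) k :
  tnth (insert_coord i a t) (lift i k) = tnth t k.
Proof. by rewrite tnth_mktuple liftK. Qed.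

Lemma measurable_tuple_consP d (T : measurableType d) n (f : T -> tR)
    (g : T -> n.-tuple tR) :
  measurable_fun setT f -> measurable_fun setT g ->
  measurable_fun setT (fun w => tuple_cons (f w, g w)).
Proof.
move=> mf mg; apply: (@measurableT_comp _ _ _ _ _ _ (@tuple_cons R n)).
  exact: measurable_tuple_cons.
exact: measurable_fun_pair.
Qed.

Lemma insert_coord0 n a (t : n.-tuple tR) : insert_coord ord0 a t =
  tuple_cons (a, t).
Proof.
apply: eq_from_tnth => j; case: (unliftP ord0 j) => [k ->|->].
  by rewrite tnth_insert_coord_lift tnthS.
by rewrite tnth_insert_coord tnth0.
Qed.

Lemma insert_coord_lift0 n (i : 'I_n.+1) a b (t : n.-tuple tR) :
  insert_coord (lift ord0 i) a (tuple_cons (b, t)) =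
    tuple_cons (b, insert_coord i a t).
Proof.
apply: eq_from_tnth => j; case: (unliftP ord0 j) => [k ->|->]; last first.
  rewrite [RHS]tnth0 (_ : ord0 = lift (lift ord0 i) ord0); last exact/val_inj.
  by rewrite tnth_insert_coord_lift tnth0.
rewrite [RHS]tnthS; case: (unliftP i k) => [l ->|->];
  last by rewrite !tnth_insert_coord.
rewrite tnth_insert_coord_lift
  (_ : lift ord0 (lift i l) = lift (lift ord0 i) (lift ord0 l)).
  by rewrite tnth_insert_coord_lift tnthS.
by apply/val_inj => /=; rewrite /bump /=; lia.
Qed.

Lemma measurable_insert_coord d (T : measurableType d) n (i : 'I_n.+1) (f : T -> tR)
    (g : T -> n.-tuple tR) :
  measurable_fun setT f -> measurable_fun setT g ->
  measurable_fun setT (fun w => insert_coord i (f w) (g w)).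
Proof.
move=> mf mg; apply/measurable_fun_tnthP => j.
rewrite (_ : _ \o _ = fun w => if unlift i j is Some k then tnth (g w) k else f w).
  case: (unlift i j) => [k|//].
  by apply: (@measurableT_comp _ _ _ _ _ _ (fun t : n.-tuple tR => tnth t k)) => //;
    exact: measurable_tnth.
by apply/funext => w /=; rewrite tnth_mktuple.
Qed.

Local Open Scope ereal_scope.

Lemma lebesgue_tuple0E (f : 0.-tuple tR -> \bar R) : measurable_fun setT f ->
  \int[lam 0%N]_t f t = f [tuple].
Proof.
move=> mf; rewrite (eq_measure_integral (dirac [tuple])) //.
by rewrite integral_dirac // diracT mul1e.
Qed.

Lemma lebesgue_tupleSE n (f : n.+1.-tuple tR -> \bar R) :
  measurable_fun setT f -> (forall t, 0 <= f t) ->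
  \int[lam n.+1]_t f t = \int[leb]_a \int[lam n]_t f (tuple_cons (a, t)).
Proof.
move=> mf f0.
have mc := @measurable_tuple_cons R n.
have <- : \int[(leb \x lam n)%E]_z f (tuple_cons z) =
    \int[leb]_a \int[lam n]_t f (tuple_cons (a, t)).
  by rewrite fubini_tonelli1 //; exact: measurableT_comp.
rewrite -(ge0_integral_pushforward mc (leb \x lam n)%E measurableT) //.
Qed.

(** Tonelli moves the integration over the i-th coordinate past the preceding
    ones, one by one. *)
Lemma lebesgue_tuple_insert_coord n (i : 'I_n.+1) (f : n.+1.-tuple tR -> \bar R) :
  measurable_fun setT f -> (forall t, 0 <= f t) ->
  \int[lam n.+1]_t f t = \int[leb]_a \int[lam n]_t f (insert_coord i a t).
Proof.
elim: n i f => [|n IHn] i f mf f0; case: (unliftP ord0 i) => [j ->|->].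
- by case: j.
- by rewrite (lebesgue_tupleSE mf f0);
  under eq_integral do under eq_integral do rewrite -insert_coord0.
- rewrite (lebesgue_tupleSE mf f0).
  have mcons (a : tR) : measurable_fun setT
    (fun t : n.+1.-tuple tR => f (tuple_cons (a, t))).
    by apply: measurableT_comp => //; exact: measurable_tuple_consP.
  under eq_integral => a _ do rewrite (IHn j _ (mcons a)) //.
  pose F (z : tR * tR) := \int[lam n]_t f (tuple_cons (z.1, insert_coord j z.2 t)).
  have mF : measurable_fun setT F.
    apply: (measurable_fun_fubini_tonelli_F
      (fun z : (tR * tR) * n.-tuple tR =>
        f (tuple_cons (z.1.1, insert_coord j z.1.2 z.2)))) => //.
    apply: measurableT_comp => //; apply: measurable_tuple_consP => //=.
      exact: measurableT_comp.
    by apply: measurable_insert_coord => //; exact: measurableT_comp.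
  rewrite (fubini_tonelli F) //; last by move=> z; exact: integral_ge0.
  apply: eq_integral => b _.
  have mins : measurable_fun setT
    (fun t : n.+1.-tuple tR => f (insert_coord (lift ord0 j) b t)).
    by apply: measurableT_comp => //; exact: measurable_insert_coord.
  have E := lebesgue_tupleSE mins (fun t => f0 _).
  have E2 := esym E.
  apply: (eq_trans _ E2).
  by apply: eq_integral => a _; apply: eq_integral => t _;
    rewrite insert_coord_lift0.
- by rewrite (lebesgue_tupleSE mf f0);
  under eq_integral do under eq_integral do rewrite -insert_coord0.
Qed.

Lemma lebesgue_tuple_affine n (c b : R) (f : n.-tuple tR -> \bar R) :
  (0 < c)%R -> measurable_fun setT f -> (forall t, 0 <= f t) ->
  \int[lam n]_t f t =
  (c ^+ n)%:E * \int[lam n]_t f [tuple (c * tnth t j + b)%R | j < n].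
Proof.
move=> c0; elim: n f => [|n IHn] f mf f0.
  rewrite !lebesgue_tuple0E //; last first.
    apply: measurableT_comp => //; apply/measurable_fun_tnthP => -[] //.
  by rewrite mul1e; congr f; apply: eq_from_tnth => -[].
have maff (m : nat) : measurable_fun setT (fun t : m.-tuple tR =>
    [tuple (c * tnth t j + b)%R | j < m] : m.-tuple tR).
  apply/measurable_fun_tnthP => j.
  rewrite (_ : _ \o _ = fun t : m.-tuple tR => (c * tnth t j + b)%R).
    apply: measurable_funD => //; apply: measurable_funM => //;
      exact: measurable_tnth.
  by apply/funext => t /=; rewrite tnth_mktuple.
have mcons (a : tR) : measurable_fun setT
  (fun t : n.-tuple tR => f (tuple_cons (a, t))).
  by apply: measurableT_comp => //; exact: measurable_tuple_consP.
pose F (z : tR * n.-tuple tR) : \bar R :=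
  f (tuple_cons (z.1, [tuple (c * tnth z.2 j + b)%R | j < n])).
have mF : measurable_fun setT F.
  apply: measurableT_comp => //; apply: measurable_tuple_consP => //.
  by apply: (@measurableT_comp _ _ _ _ _ _
    (fun t : n.-tuple tR => [tuple (c * tnth t j + b)%R | j < n])) => //;
      exact: maff.
rewrite (lebesgue_tupleSE mf f0).
rewrite (lebesgue_tupleSE (measurableT_comp mf (maff _)) (fun t => f0 _)).
under eq_integral => a _ do rewrite (IHn _ (mcons a)) //.
have mG : measurable_fun setT (fun a : tR => \int[lam n]_t F (a, t)).
  by apply: (measurable_fun_fubini_tonelli_F F) => // z; exact: f0.
have G0 (a : tR) : setT a -> 0 <= \int[lam n]_t F (a, t) by move=> _;
  apply: integral_ge0 => t _; exact: f0.
have cn0 : (0 <= c ^+ n)%R by rewrite exprn_ge0 // ltW.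
have E := ge0_integralZl_EFin leb measurableT G0 mG cn0.
apply: (eq_trans E).
rewrite (ge0_integral_affine b c0 mG); last by move=> a; exact: G0.
rewrite muleA -EFinM -exprSr; congr (_ * _).
apply: eq_integral => a _; apply: eq_integral => t _; rewrite /F /=.
congr f; apply: eq_from_tnth => j; rewrite tnth_mktuple.
case: (unliftP ord0 j) => [k ->|->]; last by rewrite !tnth0.
by rewrite !tnthS tnth_mktuple.
Qed.

Lemma measurable_mktuple d (T : measurableType d) n (F : 'I_n -> T -> tR) :
  (forall j, measurable_fun setT (F j)) ->
  measurable_fun setT (fun w => [tuple F j w | j < n] : n.-tuple tR).
Proof.
move=> mF; apply/measurable_fun_tnthP => j.
rewrite (_ : _ \o _ = F j) //.
by apply/funext => t /=; rewrite tnth_mktuple.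
Qed.

Lemma measurable_tnth_comp d (T : measurableType d) n (j : 'I_n)
    (F : T -> n.-tuple tR) :
  measurable_fun setT F -> measurable_fun setT (fun w => tnth (F w) j : tR).
Proof.
move=> mF; apply: (@measurableT_comp _ _ _ _ _ _ (fun t : n.-tuple tR => tnth t j))
  => //.
exact: measurable_tnth.
Qed.

(** The coordinate k is taken as new origin: it is translated by h, and the
    other coordinates are rescaled by c and measured from it. *)
Definition shear n (k : 'I_n) (c : R) (h : n.-tuple tR -> R) (v : n.-tuple tR) :
    n.-tuple tR :=
  [tuple if j == k then (tnth v k + h v)%R
         else (c * tnth v j + (tnth v k + h v))%R | j < n].

Lemma measurable_shear n (k : 'I_n) (c : R) (h : n.-tuple tR -> R) :
  measurable_fun setT h -> measurable_fun setT (shear k c h).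
Proof.
move=> mh; apply: measurable_mktuple => j; case: (j == k).
  by apply: measurable_funD => //; exact: measurable_tnth.
apply: measurable_funD; first by apply: measurable_funM => //;
  exact: measurable_tnth.
by apply: measurable_funD => //; exact: measurable_tnth.
Qed.

(** Since h does not look at the coordinate k, one may integrate first over
    the other coordinates with the k-th fixed (an affine change), then over
    the k-th with the others fixed (a translation). *)
Lemma lebesgue_tuple_shear n (k : 'I_n) (c : R) (h : n.-tuple tR -> R)
    (f : n.-tuple tR -> \bar R) :
  (0 < c)%R -> measurable_fun setT h ->
  (forall v w, (forall j, j != k -> tnth v j = tnth w j) -> h v = h w) ->
  measurable_fun setT f -> (forall t, 0 <= f t) ->
  \int[lam n]_t f t = (c ^+ n.-1)%:E * \int[lam n]_v f (shear k c h v).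
Proof.
case: n k h f => [[] //|n] k h f c0 mh hk mf f0 /=.
have cn0 : (0 <= c ^+ n)%R by rewrite exprn_ge0 // ltW.
pose g t (a : tR) : n.-tuple tR := [tuple (c * tnth t j + a)%R | j < n].
pose F (z : tR * n.-tuple tR) := f (insert_coord k z.1 (g z.2 z.1)).
have mF : measurable_fun setT F.
  apply: measurableT_comp => //; apply: measurable_insert_coord => //.
  apply: measurable_mktuple => j; apply: measurable_funD => //.
  by apply: measurable_funM => //; exact: measurable_tnth_comp.
have F0 z : 0 <= F z by exact: f0.
have mins (a : tR) : measurable_fun setT (fun t => f (insert_coord k a t)).
  by apply: measurableT_comp => //; exact: measurable_insert_coord.
rewrite (lebesgue_tuple_insert_coord k mf f0).
rewrite (lebesgue_tuple_insert_coord k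
  (measurableT_comp mf (measurable_shear k c mh))
  (fun t => f0 _)).
transitivity (\int[leb]_a ((c ^+ n)%:E * \int[lam n]_t F (a, t))).
  apply: eq_integral => a _.
  exact: (lebesgue_tuple_affine a c0 (mins a) (fun t => f0 _)).
have mFF := measurable_fun_fubini_tonelli_F (m2 := lam n) F mF F0.
have FF0 (a : tR) : setT a -> 0 <= \int[lam n]_t F (a, t).
  by move=> _; apply: integral_ge0 => t _; exact: F0.
have E := ge0_integralZl_EFin leb measurableT FF0 mFF cn0.
apply: (eq_trans E); congr (_ * _) => {E}.
have E := fubini_tonelli (m1 := leb) (m2 := lam n) F mF F0.
apply: (eq_trans E) => {E}.
pose h' (t : n.-tuple tR) := h (insert_coord k 0%R t).
have mh' : measurable_fun setT h'.
  by apply: measurableT_comp => //; exact: measurable_insert_coord.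
transitivity (\int[lam n]_t \int[leb]_a F ((a + h' t)%R, t)).
  apply: eq_integral => t _.
  have mFt : measurable_fun setT (fun a : tR => F (a, t)) by exact:
    measurableT_comp.
  rewrite (ge0_integral_affine (h' t) ltr01 mFt (fun a => F0 _)) mul1e.
  by apply: eq_integral => a _; rewrite mul1r.
pose F2 (z : tR * n.-tuple tR) := F ((z.1 + h' z.2)%R, z.2).
have mF2 : measurable_fun setT F2.
  apply: measurableT_comp => //; apply: measurable_fun_pair => //.
  by apply: measurable_funD => //; exact: measurableT_comp.
have E := fubini_tonelli (m1 := leb) (m2 := lam n) F2 mF2 (fun z => F0 _).
apply: (eq_trans (esym E)) => {E}.
apply: eq_integral => a _; apply: eq_integral => t _; rewrite /F2 /F /=.
congr f; apply: eq_from_tnth => j.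
have hE : h (insert_coord k a t) = h' t.
  apply: hk => i; case: (unliftP k i) => [l ->|->]; last by rewrite eqxx.
  by rewrite !tnth_insert_coord_lift.
rewrite [in RHS]tnth_mktuple hE tnth_insert_coord.
case: (unliftP k j) => [l ->|->]; last by rewrite tnth_insert_coord eqxx.
by rewrite tnth_insert_coord_lift tnth_mktuple eq_sym (negbTE (neq_lift _ _))
  tnth_insert_coord_lift.
Qed.

End tuple_integral.

(** * Densities and the reference measure *)

Section integral_density.
Local Open Scope ereal_scope.
Context d (T : measurableType d) (R : realType).
Variables (mu nu : {measure set T -> \bar R}) (g : T -> R).
Hypotheses (mg : measurable_fun setT g) (g0 : forall x, (0 <= g x)%R).
Hypothesis nuE : forall A, measurable A -> nu A = \int[mu]_(x in A) (g x)%:E.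

Import HBNNSimple.

Let nnsfun_density (h : {nnsfun T >-> R}) :
  \int[nu]_x (h x)%:E = \int[mu]_x ((h x)%:E * (g x)%:E).
Proof.
have g0' x : 0 <= (g x)%:E by rewrite lee_fin.
have mg' : measurable_fun setT (EFin \o g) by exact/measurable_EFinP.
have ind0 y x : 0 <= (y * \1_(h @^-1` [set y]) x)%:E by exact: nnfun_muleindic_ge0.
have mind y : measurable_fun setT (fun x => (y * \1_(h @^-1` [set y]) x)%:E).
  by apply/measurable_EFinP; exact: measurable_funM.
transitivity (\int[nu]_x (\sum_(y \in range h) (y * \1_(h @^-1` [set y]) x)%:E)).
  by apply: eq_integral => t tE; rewrite /= fimfunE -fsumEFin.
rewrite ge0_integral_fsum //.
transitivity (\int[mu]_x (\sum_(y \in range h)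
    ((y * \1_(h @^-1` [set y]) x)%:E * (g x)%:E))); last first.
  apply: eq_integral => x _; rewrite -ge0_mule_fsuml => [|y]; last exact: ind0.
  by rewrite fsumEFin // -(fimfunE _ x).
rewrite ge0_integral_fsum//; last 2 first.
  - by move=> y; apply: emeasurable_funM.
  - by move=> y x _; rewrite mule_ge0.
apply: eq_fsbigr => r /set_mem [x0 _ hx0].
have r0 : (0 <= r)%R by rewrite -hx0.
rewrite integralZl_indic_nnsfun // integral_indic // setIT nuE //.
transitivity (r%:E * \int[mu]_x ((\1_(h @^-1` [set r]) x)%:E * (g x)%:E)).
  congr (_ * _); rewrite integral_mkcond; apply: eq_integral => x _.
  by rewrite epatch_indic muleC.
rewrite -ge0_integralZl_EFin //.
- by apply: eq_integral => x _; rewrite EFinM muleA.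
- by move=> x _; rewrite mule_ge0 // lee_fin.
- by apply: emeasurable_funM => //; exact/measurable_EFinP.
Qed.

(** By monotone convergence from simple functions, for which it is the
    definition of the density. *)
Lemma ge0_integral_density (f : T -> R) : measurable_fun setT f ->
  (forall x, (0 <= f x)%R) ->
  \int[nu]_x (f x)%:E = \int[mu]_x (f x * g x)%:E.
Proof.
move=> mf f0; have mf' : measurable_fun setT (EFin \o f) by exact/measurable_EFinP.
pose h := nnsfun_approx measurableT mf'.
have hc x : (EFin \o h n) x @[n --> \oo] --> (f x)%:E.
  by apply: (cvg_nnsfun_approx measurableT mf') => // y _; rewrite /= lee_fin.
have mhn n : measurable_fun setT (EFin \o h n) by exact/measurable_EFinP.
have mg' : measurable_fun setT (EFin \o g) by exact/measurable_EFinP.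
transitivity (limn (fun n => \int[nu]_x (h n x)%:E)).
  rewrite -monotone_convergence //.
  - by apply: eq_integral => x _; apply/esym/cvg_lim => //; exact: hc.
  - by move=> n x _; rewrite lee_fin.
  - by move=> x _ a b ab; rewrite lee_fin; exact/lefP/nd_nnsfun_approx.
transitivity (limn (fun n => \int[mu]_x ((h n x)%:E * (g x)%:E))).
  by congr (limn _); apply/funext => n; exact: nnsfun_density.
rewrite -monotone_convergence //.
- apply: eq_integral => x _; apply/cvg_lim => //; rewrite EFinM.
  by apply: cvgeZr => //; exact: hc.
- by move=> n; apply: emeasurable_funM => //; exact: mhn.
- by move=> n x _; rewrite mule_ge0 // lee_fin.
- move=> x _ a b ab; rewrite lee_wpmul2r ?lee_fin //.
  exact/lefP/nd_nnsfun_approx.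
Qed.

End integral_density.

Section reference_measure.
Variables (R : realType) (V : finType) (e : rel V).
Local Notation RV := (RV R V).
Local Notation lam := (@lebesgue_tuple R #|V|).
Local Open Scope ereal_scope.

Lemma sigma_finite_lam2 : sigma_finite setT (lam \x lam).
Proof.
by case: (lebesgue_integral_fubini.measure_function_Measure_isSigmaFinite__to__measure_function_isSigmaFinite
    lam lam).
Qed.

Lemma integral_tree_counting (h : spanning_tree e -> R) : (forall T, (0 <= h T)%R)
  ->
  \int[tree_counting R (e := e)]_T (h T)%:E = \sum_T (h T)%:E.
Proof.
move=> h0.
transitivity (\int[tree_counting R (e := e)]_T \sum_(U : spanning_tree e)
   (h U * \1_[set U] T)%:E).
  apply: eq_integral => T _; rewrite (bigD1 T) //= indicE mem_set // mulr1.
  rewrite big1 ?adde0 // => U UT; rewrite indicE memNset ?mulr0 //.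
  by move=> /= TU; move: UT; rewrite TU eqxx.
rewrite ge0_integral_sum //; last first.
  by move=> U T _; rewrite lee_fin mulr_ge0 // indicE.
apply: eq_bigr => U _.
under eq_integral do rewrite EFinM.
rewrite ge0_integralZl_EFin //.
rewrite integral_indic // setIT -[X in _ * X]/(counting [set U]) /counting.
by rewrite asboolT // fset_set1 finmap.cardfs1 mule1.
Qed.

Lemma measurable_tree_sections d (T : measurableType d)
    (f : RV * RV * spanning_tree e -> T) :
  (forall U, measurable_fun setT (fun z => f (z, U))) -> measurable_fun setT f.
Proof.
move=> mf _ Y mY; rewrite setTI.
have -> : f @^-1` Y = \bigcup_(U in [set: spanning_tree e])
    (((fun z => f (z, U)) @^-1` Y) `*` [set U]).
  apply/seteqP; split => [[w U] /= wY|[w U] /= [U' _ []]] /=; first by exists U.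
  by move=> ? ->.
apply: fin_bigcup_measurable => [|U _]; first exact: finite_finset.
apply: measurableX => //.
by rewrite -[X in measurable X]setTI; exact: mf.
Qed.

Lemma measurable_tree_section d (T : measurableType d)
    (f : RV * RV * spanning_tree e -> T) U :
  measurable_fun setT f -> measurable_fun setT (fun z => f (z, U)).
Proof. by move=> mf; apply: measurableT_comp => //; exact: measurable_pair2. Qed.

Lemma integral_ref_measure (f : RV * RV * spanning_tree e -> R) :
  measurable_fun setT f -> (forall w, (0 <= f w)%R) ->
  \int[@ref_measure R V e]_w (f w)%:E =
  \int[lam \x lam]_z (\sum_T f (z, T))%:E.
Proof.
move=> mf f0.
pose l2 : {sigma_finite_measure set (RV * RV)%type -> \bar R} :=
  HB.pack (lam \x lam) (Measure_isSigmaFinite.Build _ _ _ (lam \x lam)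
    sigma_finite_lam2).
have mf' : measurable_fun setT (EFin \o f) by exact/measurable_EFinP.
have E := fubini_tonelli1 (m1 := l2) (m2 := tree_counting R (e := e)) _ mf'
  (fun w => f0 w).
apply: (eq_trans E); apply: eq_integral => z _.
rewrite /fubini_F integral_tree_counting //.
by rewrite sumEFin.
Qed.

Variable beta : V -> V -> R.

Lemma expectE (eps : V -> R) (f : config R e -> R) : symmetric e ->
  (forall i j, e i j -> (0 < beta i j)%R) -> (forall i, (0 <= eps i)%R) ->
  measurable_fun setT f -> (forall w, (0 <= f w)%R) ->
  expect beta eps f =
  \int[lam \x lam]_z (\sum_T f (z, T) * density beta eps (z, T))%:E.
Proof.
move=> es b0 e0 mf f0; have [m mE] := mu_is_measure es b0 e0.
rewrite /expect mE.
have md := @measurable_density R V e beta eps.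
have d0 w : (0 <= @density R V e beta eps w)%R by exact: density_ge0.
rewrite (@ge0_integral_density _ _ _ (@ref_measure R V e) m _ md d0) //.
- rewrite (@integral_ref_measure (fun w => f w * density beta eps w)%R) //.
    exact: measurable_funM.
  by move=> w; exact: mulr_ge0.
- by move=> A _; rewrite -mE.
Qed.

End reference_measure.

(** * A triangular change of variables for pairs *)

Section shear_pair.
Variables (R : realType) (n : nat) (k : 'I_n).
Local Notation tR := (measurableTypeR R).
Local Notation tup := (n.-tuple tR).
Local Notation lam := (@lebesgue_tuple R n).
Local Open Scope ereal_scope.

(** The scale c applied to the second component depends on the transformed
    first component, while the shift h of the first component may depend on
    all of the second: the map is a composition of a shear of the second
    component at fixed first and one of the first at fixed second. *)
Definition shear_pair (c : tR -> R) (h : tup * tup -> R) (z : tup * tup) : tup * tup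
  :=
  let t := shear k 1 (fun v => h (v, z.2)) z.1 in
  (t, shear k (c (tnth t k)) (fun=> 0%R) z.2).

Lemma measurable_shear_comp d (T : measurableType d) (c h : T -> tR)
    (F : T -> tup) :
  measurable_fun setT c -> measurable_fun setT h -> measurable_fun setT F ->
  measurable_fun setT (fun w => shear k (c w) (fun=> h w) (F w)).
Proof.
move=> mc mh mF; apply: measurable_mktuple => j; case: (j == k).
  by apply: measurable_funD => //; exact: measurable_tnth_comp.
apply: measurable_funD; first by apply: measurable_funM => //;
  exact: measurable_tnth_comp.
by apply: measurable_funD => //; exact: measurable_tnth_comp.
Qed.

Lemma measurable_shear_pair (c : tR -> R) (h : tup * tup -> R) :
  measurable_fun setT c -> measurable_fun setT h ->
  measurable_fun setT (shear_pair c h).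
Proof.
move=> mc mh.
have mt : measurable_fun setT
  (fun z : tup * tup => shear k 1 (fun v => h (v, z.2)) z.1).
  rewrite (_ : (fun _ => _) = fun z : tup * tup => shear k 1 (fun=> h z) z.1).
    exact: measurable_shear_comp.
  by apply/funext => -[v s].
apply: measurable_fun_pair => //; apply: measurable_shear_comp => //.
by apply: measurableT_comp => //; exact: measurable_tnth_comp.
Qed.

(** Two applications of [lebesgue_tuple_shear], one in each component, with an
    exchange of the order of integration between them. The shear of the second
    component fixes its k-th coordinate and the Jacobian is that of the
    remaining ones. *)
Lemma integral_shear_pair (c : tR -> R) (h : tup * tup -> R)
    (f : tup * tup -> \bar R) :
  measurable_fun setT c -> (forall u, (0 < c u)%R) -> measurable_fun setT h ->
  (forall v w s, (forall j, j != k -> tnth v j = tnth w j) -> h (v, s) = h (w, s))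
    ->
  measurable_fun setT f -> (forall z, 0 <= f z) ->
  \int[lam \x lam]_z f z = \int[lam \x lam]_z
    (((c (tnth (shear_pair c h z).1 k)) ^+ n.-1)%:E * f (shear_pair c h z)).
Proof.
move=> mc c0 mh hk mf f0.
pose g (z : tup * tup) : \bar R := (c (tnth z.1 k) ^+ n.-1)%:E *
  f (z.1, shear k (c (tnth z.1 k)) (fun=> 0%R) z.2).
have mck : measurable_fun setT (fun z : tup * tup => c (tnth z.1 k) : tR).
  by apply: measurableT_comp => //; exact: measurable_tnth_comp.
have mg : measurable_fun setT g.
  apply: emeasurable_funM.
    by apply/measurable_EFinP; exact: measurable_funX.
  apply: measurableT_comp => //; apply: measurable_fun_pair => //.
  exact: measurable_shear_comp.
have g0 z : 0 <= g z by rewrite mule_ge0 // lee_fin exprn_ge0 // ltW.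
rewrite (fubini_tonelli1 (m1 := lam) (m2 := lam) f mf f0).
transitivity (\int[lam]_t \int[lam]_s g (t, s)).
  apply: eq_integral => t _; rewrite /fubini_F.
  have mft : measurable_fun setT (fun s => f (t, s)) by exact: measurableT_comp.
  have E := lebesgue_tuple_shear (k := k) (c0 (tnth t k))
    (measurable_cst (0%R : tR)) (fun _ _ _ => erefl) mft (fun s => f0 _).
  apply: (eq_trans E); rewrite {E}.
  have mfs : measurable_fun setT
    (fun s => f (t, shear k (c (tnth t k)) (fun=> 0%R) s)).
    apply: (measurableT_comp mft); exact: measurable_shear.
  have cn0 : (0 <= c (tnth t k) ^+ n.-1)%R by rewrite exprn_ge0 // ltW.
  have E := ge0_integralZl_EFin lam measurableT (fun s _ => f0 _) mfs cn0.
  exact: (eq_trans (esym E)).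
have E := fubini_tonelli (m1 := lam) (m2 := lam) g mg g0.
apply: (eq_trans E); rewrite {E}.
have mgP : measurable_fun setT (fun z => g ((shear_pair c h z).1, z.2)).
  apply: measurableT_comp => //; apply: measurable_fun_pair => //.
  by apply: measurableT_comp => //; exact: measurable_shear_pair.
have E := fubini_tonelli2 (m1 := lam) (m2 := lam) _ mgP (fun z => g0 _).
apply: (eq_trans _ (esym E)); rewrite {E}.
apply: eq_integral => s _; rewrite /fubini_G.
have mgs : measurable_fun setT (fun t => g (t, s)) by exact: measurableT_comp.
have mhs : measurable_fun setT (fun v => h (v, s)) by exact: measurableT_comp.
have E := lebesgue_tuple_shear ltr01 mhs (fun v w => hk v w s) mgs (fun t => g0 _).
by apply: (eq_trans E); rewrite expr1n mul1e.
Qed.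

End shear_pair.

(** * Products of Cauchy densities *)

Section product_bounds.
Variable R : realType.
Local Notation tR := (measurableTypeR R).
Local Notation leb := (@lebesgue_measure R).
Local Notation lam n := (@lebesgue_tuple R n).
Local Open Scope ereal_scope.

(** The Cauchy density without its normalisation; it is used as the reference
    decay in every coordinate because its integral over the line is known. *)
Definition bell (u : R) : R := (1 + u ^+ 2)^-1.

Lemma bell_gt0 u : (0 < bell u)%R.
Proof. by rewrite invr_gt0; have := sqr_ge0 u; lra. Qed.

Lemma measurable_bell : measurable_fun setT (bell : tR -> tR).
Proof. exact: continuous_measurable_fun (@continuous_oneDsqrV R). Qed.

Lemma integral_bell_lty : \int[leb]_u (bell u)%:E < +oo.
Proof.
rewrite ge0_symfun_integralT.
- rewrite -set_itvcy (_ : \int[_]_(x in _) _ = (pi / 2)%:E) ?ltry //.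
  exact: integral0y_oneDsqr.
- by move=> u; exact/ltW/bell_gt0.
- exact: continuous_oneDsqrV.
- by move=> u /=; rewrite /bell sqrrN.
Qed.

Definition bell_prod n (t : n.-tuple tR) : R := \prod_(j < n) bell (tnth t j).

Lemma bell_prod_gt0 n (t : n.-tuple tR) : (0 < bell_prod t)%R.
Proof. by apply: prodr_gt0 => j _; exact: bell_gt0. Qed.

Lemma measurable_bell_prod n : measurable_fun setT (@bell_prod n : _ -> tR).
Proof.
apply: measurable_prod => j _; apply: measurableT_comp;
  first exact: measurable_bell.
exact: measurable_tnth.
Qed.

Lemma integral_bell_prod_lty n : \int[lam n]_t (bell_prod t)%:E < +oo.
Proof.
elim: n => [|n IHn].
  rewrite lebesgue_tuple0E ?ltry //; apply/measurable_EFinP;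
    exact: measurable_bell_prod.
have mE (m : nat) : measurable_fun setT (fun t : m.-tuple tR => (bell_prod t)%:E).
  by apply/measurable_EFinP; exact: measurable_bell_prod.
have c0 (m : nat) (t : m.-tuple tR) : 0 <= (bell_prod t)%:E.
  by rewrite lee_fin ltW // bell_prod_gt0.
rewrite (lebesgue_tupleSE (mE _) (c0 _)).
rewrite (_ : \int[_]_a _ =
  \int[leb]_a ((bell a)%:E * \int[lam n]_t (bell_prod t)%:E)).
  have mc : measurable_fun setT (EFin \o bell).
    by apply/measurable_EFinP; exact: measurable_bell.
  have c0' u : setT u -> 0 <= (EFin \o bell) u by rewrite lee_fin ltW // bell_gt0.
  have fin : \int[lam n]_t (bell_prod t)%:E \is a fin_num.
    by rewrite ge0_fin_numE // integral_ge0.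
  rewrite -(fineK fin).
  have E := ge0_integralZr leb measurableT mc
    (k := (fine (\int[lam n]_t (bell_prod t)%:E))%:E) c0'.
  rewrite E ?fineK ?integral_ge0 // lte_mul_pinfty ?integral_ge0 //.
    by rewrite ge0_fin_numE ?integral_bell_lty // integral_ge0.
apply: eq_integral => a _.
have E := ge0_integralZl_EFin (lam n) measurableT (fun t _ => c0 n t) (mE n)
  (ltW (bell_gt0 a)).
apply: (eq_trans _ E); apply: eq_integral => t _; rewrite -EFinM; congr EFin.
rewrite /bell_prod big_ord_recl; congr (bell _ * _)%R.
by apply: eq_bigr => j _; rewrite tnthS.
Qed.

Lemma integral_bell_prod2_lty n :
  \int[lam n \x lam n]_z (bell_prod z.1 * bell_prod z.2)%:E < +oo.
Proof.
have c0 (t : n.-tuple tR) : 0 <= (bell_prod t)%:E.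
  by rewrite lee_fin ltW // bell_prod_gt0.
have mE : measurable_fun setT (fun t : n.-tuple tR => (bell_prod t)%:E).
  by apply/measurable_EFinP; exact: measurable_bell_prod.
have E := fubini_tonelli1 (m1 := lam n) (m2 := lam n)
  (fun z => (bell_prod z.1 * bell_prod z.2)%:E).
rewrite E; last 2 first.
- apply/measurable_EFinP; apply: measurable_funM.
    by apply: measurableT_comp => //; exact: measurable_bell_prod.
  by apply: measurableT_comp => //; exact: measurable_bell_prod.
- by move=> z; rewrite EFinM mule_ge0.
set K := \int[lam n]_t (bell_prod t)%:E.
have Kfin : K \is a fin_num.
  by rewrite ge0_fin_numE ?integral_bell_prod_lty // integral_ge0.
rewrite (_ : \int[_]_t _ = \int[lam n]_t ((bell_prod t)%:E * K)).
  rewrite -(fineK Kfin).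
  have E2 := ge0_integralZr (lam n) measurableT mE (k := (fine K)%:E)
    (fun t _ => c0 t).
  rewrite E2 ?fineK ?integral_ge0 // lte_mul_pinfty ?integral_ge0 //.
  exact: integral_bell_prod_lty.
apply: eq_integral => t _; rewrite /fubini_F /=.
have E2 := ge0_integralZl_EFin (lam n) measurableT (fun t _ => c0 t) mE
  (ltW (bell_prod_gt0 t)).
by apply: (eq_trans _ E2); apply: eq_integral => s _; rewrite -EFinM.
Qed.

Lemma lebesgue_tuple_setT_gt0 n : 0 < lam n setT.
Proof.
elim: n => [|n IHn] /=; first by rewrite diracT lte_fin.
rewrite /pushforward preimage_setT -setXTT.
have E := product_measure1E leb (lam n) measurableT measurableT.
rewrite E; apply: mule_gt0 => //.
have le01 : leb [set` Interval (BLeft 0%R) (BLeft 1%R)] <= leb setT.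
  by apply: le_measure => //; rewrite inE //; exact: measurable_itv.
by apply: lt_le_trans le01;
  rewrite lebesgue_measure_itv /= lte_fin ltr01 oppr0 adde0 lte_fin.
Qed.

(** If the integral vanished, so would f almost everywhere, although the whole
    space has positive measure. *)
Lemma integral_lam2_gt0 n (f : n.-tuple tR * n.-tuple tR -> R) :
  measurable_fun setT f -> (forall z, (0 < f z)%R) ->
  0 < \int[lam n \x lam n]_z (f z)%:E.
Proof.
move=> mf f0; rewrite lt_neqAle integral_ge0 ?andbT; last first.
  by move=> z _; rewrite lee_fin ltW.
apply/eqP => /esym I0.
have mf' : measurable_fun setT (EFin \o f) by exact/measurable_EFinP.
have := ae_eq_integral_abs (lam n \x lam n) measurableT mf'.
rewrite (_ : \int[_]_(x in _) _ = 0); last first.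
  rewrite -[RHS]I0; apply: eq_integral => z _ /=.
  by rewrite gtr0_norm.
case=> /(_ erefl) [N [mN N0 sub]] _.
have : (lam n \x lam n) setT = 0.
  apply: (subset_measure0 _ mN _ N0) => // z _; apply: sub => /= /(_ Logic.I) [] fz.
  by have := f0 z; rewrite fz ltxx.
rewrite -setXTT.
have E := product_measure1E (lam n) (lam n) measurableT measurableT.
rewrite E => /eqP; rewrite mule_eq0 orbb gt_eqF //.
exact: lebesgue_tuple_setT_gt0.
Qed.

End product_bounds.

(** * Spanning trees of finite graphs *)

Section trees.
Variable W : finType.
Implicit Types (S T : {set {set W}}) (i j : W).

Lemma adj_sym S : symmetric (adj S).
Proof. by move=> i j; rewrite /adj finset.setUC. Qed.

Lemma adjS S T i j : S \subset T -> adj S i j -> adj T i j.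
Proof. by move=> /fintype.subsetP; apply. Qed.

Lemma connected_to (r : rel W) w0 : symmetric r ->
  (forall i, connect r i w0) -> connected_graph r.
Proof.
move=> rs h; apply/forallP => i; apply/forallP => j.
by apply: connect_trans (h i) _; rewrite (sym_connect_sym rs).
Qed.

Lemma set2_inj i j k l : [set i; j]%SET = [set k; l]%SET ->
  (i = k /\ j = l) \/ (i = l /\ j = k).
Proof.
move=> E.
have := set21 i j; have := set22 i j; have := set21 k l; have := set22 k l.
rewrite -{1 2}E {3 4}E !inE.
by do 4![move=> /orP[] /eqP ?]; subst; auto.
Qed.

(** In a cycle with at least three vertices the successor and the predecessor
    of a vertex differ. *)
Lemma ucycle_pred (r : rel W) (c : seq W) i : ucycle r c -> i \in c ->
  (2 < size c)%N -> symmetric r ->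
  exists j k, [/\ j \in c, k \in c, j != k, r i j & r i k].
Proof.
move=> uc ic sc rs; case: (rot_to ic) => n c' E.
have memE : c =i i :: c' by move=> z; rewrite -E mem_rot.
have uc' : ucycle r (i :: c') by rewrite -E rot_ucycle.
have sc' : (2 < size (i :: c'))%N by rewrite -E size_rot.
case: c' E memE uc' sc' => [|j [|k c']] // _ memE;
  rewrite /ucycle /ucycleb => /andP[].
rewrite /cycle rcons_path => /= /andP[/andP[rij _] rlast] uq _.
exists j, (last k c'); split => //.
- by rewrite memE !inE eqxx orbT.
- by rewrite memE !inE; have := mem_last k c'; rewrite inE => ->; rewrite !orbT.
- case/and3P: uq => _ /[swap] _; apply: contraNneq => ->; exact: mem_last.
- by rewrite rs.
Qed.

Section parents.
Variables (w0 : W) (par : W -> W) (d : W -> nat).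
Hypothesis dpar : forall i, i != w0 -> (d (par i) < d i)%N.

Definition parent_edges : {set {set W}} :=
  [set [set i; par i]%SET | i in [set~ w0]%SET]%SET.

Lemma connected_parent_edges : connected_graph (adj parent_edges).
Proof.
apply: (@connected_to _ w0) => [|i]; first exact: adj_sym.
have [n] := ubnP (d i); elim: n i => // n IHn i; rewrite ltnS => din.
have [->//|iw0] := eqVneq i w0.
apply: (@connect_trans _ _ (par i)); last first.
  by apply: IHn; exact: leq_trans (dpar iw0) din.
by apply: connect1; rewrite /adj; apply/imsetP; exists i; rewrite // !inE.
Qed.

(** The edge determines the vertex it starts from, since only the other end is
    closer to w0. *)
Lemma card_parent_edges : #|parent_edges| = #|W|.-1.
Proof.
rewrite card_in_imset; first by rewrite cardsC1.
move=> i j; rewrite !inE => iw0 jw0 /set2_inj[[]//|[ij ji]].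
by have := dpar iw0; have := dpar jw0; rewrite ji ij; lia.
Qed.

(** A vertex of a cycle that is farthest from w0 could only be joined to its
    own parent within the cycle, so its two neighbours there would coincide. *)
Lemma acyclic_parent_edges : acyclic_graph (adj parent_edges).
Proof.
move=> c uc; rewrite leqNgt; apply/negP => sc.
have [z zc] : exists z, z \in c by case: c {uc} sc => // z c _; exists z;
  rewrite mem_head.
case: (arg_maxnP d zc) => i ic imax.
have [j [k [jc kc jk aij aik]]] := ucycle_pred uc ic sc (adj_sym _).
suff par_unique l : l \in c -> adj parent_edges i l -> l = par i.
  by move: jk; rewrite (par_unique _ jc aij) (par_unique _ kc aik) eqxx.
move=> lc /imsetP[m]; rewrite !inE => mw0 /set2_inj[[->//]|[iE lE]].
by have := dpar mw0; have := imax _ lc; rewrite -iE -lE /=; lia.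
Qed.

End parents.

Lemma distance_to (r : rel W) w0 : connected_graph r ->
  exists d : W -> nat, forall i, i != w0 -> exists2 j, r i j & (d j < d i)%N.
Proof.
move=> /forallP conn.
have ex i : exists n, [exists p : n.-tuple W, path r i p && (last i p == w0)].
  have /connectP[p rp lp] := forallP (conn i) w0.
  by exists (size p); apply/existsP; exists (in_tuple p); rewrite rp -lp eqxx.
exists (fun i => ex_minn (ex i)) => i iw0.
case: ex_minnP => n /existsP[p /andP[rp /eqP lp]] _.
case: p rp lp => -[|j p] /= sp; first by move=> _ ii; rewrite ii eqxx in iw0.
move=> /andP[rij rp] lp; exists j => //.
case: ex_minnP => m _ /(_ (size p)) h.
rewrite -(eqP sp) ltnS; apply: h; apply/existsP.
by exists (in_tuple p); rewrite rp /= lp eqxx.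
Qed.

(** Each vertex is joined to a neighbour that is closer to w0, as in a
    breadth-first search. *)
Lemma spanning_subtree S (w0 : W) : connected_graph (adj S) ->
  exists T, [/\ T \subset S, connected_graph (adj T), acyclic_graph (adj T) &
    #|T| = #|W|.-1].
Proof.
move=> /(@distance_to _ w0)[d dP].
have parP i : exists j, i != w0 -> adj S i j /\ (d j < d i)%N.
  have [->|/dP[j rij dj]] := eqVneq i w0; first by exists w0.
  by exists j.
have [par {}parP] := choice parP.
have dpar i : i != w0 -> (d (par i) < d i)%N by case/parP.
exists (parent_edges w0 par); split.
- apply/fintype.subsetP => E /imsetP[i]; rewrite !inE => /parP[aij _] ->;
  exact: aij.
- exact: connected_parent_edges dpar.
- exact: acyclic_parent_edges dpar.
- exact: card_parent_edges dpar.
Qed.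

(** An edge of T outside S would close a cycle with a path of S that joins its
    ends. *)
Lemma acyclic_minimal S T :
  (forall E, E \in T -> exists i j, i != j /\ E = [set i; j]%SET) ->
  acyclic_graph (adj T) -> S \subset T -> connected_graph (adj S) -> S = T.
Proof.
move=> T2 acT ST /forallP conn; apply/eqP; rewrite finset.eqEsubset ST /=.
apply/fintype.subsetP => E ET; have [i [j [ij EE]]] := T2 _ ET.
apply/negPn/negP => ES.
have /connectP[p0 p0S lp0] := forallP (conn i) j.
case/shortenP: p0S lp0 => p pS up _ lp.
suff : (size (i :: p) <= 2)%N.
  case: p pS up lp => [|k [|l p]] //=; first by move=> _ _ ji;
    rewrite ji eqxx in ij.
  by rewrite andbT => aik _ ji _; move: ES; rewrite EE ji => /negP; apply.
apply: acT; rewrite /ucycle /ucycleb up andbT /cycle rcons_path -lp.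
apply/andP; split; last by rewrite adj_sym /adj -EE.
by apply: sub_path pS => k l; exact: adjS.
Qed.

Lemma edgesP (r : rel W) E : irreflexive r -> E \in edges r ->
  exists i j, i != j /\ E = [set i; j]%SET.
Proof.
move=> ri /imsetP[[i j]]; rewrite inE /= => rij ->; exists i, j; split=> //.
by apply: contraTneq rij => ->; rewrite ri.
Qed.

Lemma adj_edges (r : rel W) : symmetric r -> adj (edges r) =2 r.
Proof.
move=> rs i j; apply/imsetP/idP => [[[k l]]|rij]; last by exists (i, j);
  rewrite ?inE.
by rewrite inE /= => rkl /set2_inj[[-> ->]//|[-> ->]]; rewrite rs.
Qed.

Lemma spanning_treeP (r : rel W) T : irreflexive r -> is_spanning_tree r T ->
  forall E, E \in T -> exists i j, i != j /\ E = [set i; j]%SET.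
Proof. by move=> ri /and3P[/fintype.subsetP sub _ _] E /sub; exact: edgesP. Qed.

(** By minimality a spanning tree coincides with its own breadth-first
    subtree, whose edges are counted by the vertices other than the base
    point. *)
Lemma card_spanning_tree (r : rel W) T (w0 : W) : irreflexive r ->
  is_spanning_tree r T -> #|T| = #|W|.-1.
Proof.
move=> ri sT; have /and3P[_ conn /asboolP ac] := sT.
have [S [ST cS _ <-]] := spanning_subtree w0 conn.
by rewrite (acyclic_minimal (spanning_treeP ri sT) ac ST cS).
Qed.

(** The index set of [edge_prod], where every edge is read once, its ends
    ordered by [enum_rank]. *)
Definition oriented_edge S : pred (W * W) :=
  [pred p | (enum_rank p.1 < enum_rank p.2)%N && adj S p.1 p.2].

Lemma card_oriented_edge S :
  (forall E, E \in S -> exists i j, i != j /\ E = [set i; j]%SET) ->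
  #|oriented_edge S| = #|S|.
Proof.
move=> S2; rewrite [in RHS](_ : S =
  [set [set p.1; p.2]%SET | p in oriented_edge S]%SET).
  rewrite card_in_imset //.
  move=> [i j] [k l]; rewrite !inE /= =>
    /andP[ij _] /andP[kl _] /set2_inj[[-> ->]//|[ii jj]].
  by move: ij kl; rewrite ii jj; lia.
apply/setP => E; apply/idP/imsetP => [ES|[[i j]]];
  last by rewrite inE /= => /andP[_ ?] ->.
have [i [j [ij EE]]] := S2 _ ES.
have : (enum_rank i != enum_rank j :> nat) by rewrite (inj_eq val_inj)
  (inj_eq enum_rank_inj).
rewrite neq_ltn => /orP[lt|lt]; first by exists (i, j);
  rewrite // inE /= lt /adj -EE.
by exists (j, i); rewrite ?inE /= ?lt /adj finset.setUC -EE.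
Qed.

End trees.

Section option_graph.
Variables (V : finType).

Lemma big_option (T : Type) (idx : T) (op : Monoid.com_law idx)
  (P : pred (option V))
    (F : option V -> T) :
  \big[op/idx]_(i | P i) F i =
  op (if P None then F None else idx)
    (\big[op/idx]_(v : V | P (Some v)) F (Some v)).
Proof.
rewrite (bigID (fun i => i == None)) /=; congr (op _ _).
  case: ifP => PN.
    rewrite (big_pred1 None) // => i /=; rewrite /pred1 /=.
    by case: eqP => [->|]; rewrite ?PN ?andbF.
  by rewrite big1 // => i /andP[Pi /eqP iN]; rewrite iN PN in Pi.
rewrite (reindex_omap Some id) /=; last by case=> // /andP[].
by apply: eq_bigl => v; rewrite eqxx !andbT.
Qed.

Definition inner_edge (T : {set {set (option V)}}) : pred (V * V) :=
  [pred p | oriented_edge T (Some p.1, Some p.2)].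

Definition rho_nbr T : pred V := [pred v | adj T (Some v) None].

(** Edges at rho are read in either orientation according to [enum_rank],
    hence the symmetry required of F. *)
Lemma big_oriented_edge (X : Type) (idx : X) (op : Monoid.com_law idx)
    (T : {set {set (option V)}}) (F : option V -> option V -> X) :
  (forall v, F (Some v) None = F None (Some v)) ->
  \big[op/idx]_(p | oriented_edge T p) F p.1 p.2 =
  op (\big[op/idx]_(v | rho_nbr T v) F (Some v) None)
     (\big[op/idx]_(p | inner_edge T p) F (Some p.1) (Some p.2)).
Proof.
move=> Fs.
rewrite -(pair_big_dep xpredT (fun i j => oriented_edge T (i, j))
  (fun i j => F i j)) /=.
rewrite big_option /=.
rewrite (eq_bigr (fun v =>
  op (if oriented_edge T (Some v, None) then F (Some v) None else idx)
   (\big[op/idx]_(w | oriented_edge T (Some v, Some w)) F (Some v) (Some w))));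
     last first.
  by move=> v _; rewrite big_option.
rewrite big_split /= Monoid.mulmA; congr (op _ _); last first.
  by rewrite (pair_big_dep xpredT (fun i j => oriented_edge T (Some i, Some j))
    (fun i j => F (Some i) (Some j))).
rewrite big_option /oriented_edge /= ltnn /= Monoid.mul1m.
rewrite [X in op X _]big_mkcond -big_split [RHS]big_mkcond /=.
apply: eq_bigr => v _; rewrite /rho_nbr /= [adj T None _]adj_sym.
case: (adj T (Some v) None); rewrite ?andbF ?andbT ?Monoid.mul1m //.
have : (enum_rank (Some v) != enum_rank (None : option V) :> nat).
  by rewrite (inj_eq val_inj) (inj_eq enum_rank_inj).
by rewrite neq_ltn; case: ltngtP => //= _ _;
  rewrite ?Monoid.mul1m ?Monoid.mulm1 // Fs.
Qed.

End option_graph.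

(** * Trees attached to rho by a single edge *)

Section rooted_trees.
Variables (V : finType) (e : rel V).
Hypotheses (es : symmetric e) (ei : irreflexive e).
Local Notation tree := (spanning_tree e).

Lemma ext_sym : symmetric (ext_rel e).
Proof. by move=> [a|] [b|] //=; rewrite es. Qed.

Lemma ext_irr : irreflexive (ext_rel e).
Proof. by move=> [a|] //=; rewrite ei. Qed.

Lemma in_edges_ext i j : ([set i; j]%SET \in edges (ext_rel e)) = ext_rel e i j.
Proof. exact: adj_edges ext_sym i j. Qed.

Lemma adj_ext (T : tree) i j : adj (val T) i j -> ext_rel e i j.
Proof.
case/and3P: (valP T) => /fintype.subsetP sub _ _ /sub h.
by rewrite -(adj_edges ext_sym).
Qed.

Lemma connected_tree (T : tree) i j : connect (adj (val T)) i j.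
Proof. by case/and3P: (valP T) => _ /forallP/(_ i)/forallP/(_ j). Qed.

Lemma card_tree (T : tree) : (#|rho_nbr (val T)| + #|inner_edge (val T)| = #|V|)%N.
Proof.
have := card_spanning_tree None ext_irr (valP T); rewrite card_option /= => <-.
rewrite -(card_oriented_edge (spanning_treeP ext_irr (valP T))).
have := @big_oriented_edge V nat 0%N addn (val T) (fun _ _ => 1%N) (fun _ => erefl).
by rewrite !sum1_card => ->.
Qed.

(** Without an edge at rho the set of all other vertices would be a union of
    connected components. *)
Lemma rho_nbr_neq0 (T : tree) (x : V) : (0 < #|rho_nbr (val T)|)%N.
Proof.
rewrite lt0n; apply/negP => /eqP r0.
have cl : fingraph.closed (adj (val T)) [pred i : option V | i != None].
  apply: (intro_closed (sym_connect_sym (adj_sym _))) => i [w|] // aij.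
  case: i aij => // v aij _; rewrite inE.
  by have := card0_eq r0 v; rewrite !inE aij.
by have := closed_connect cl (connected_tree T None (Some x)).
Qed.

Definition rooted (r : V) (T : tree) : bool :=
  [forall v, rho_nbr (val T) v ==> (v == r)].

Lemma rootedP r (T : tree) : reflect (forall v, rho_nbr (val T) v = (v == r))
  (rooted r T).
Proof.
apply: (iffP forallP) => [h v|h v]; last by rewrite h implybb.
apply/idP/eqP => [rv|->]; first exact/eqP/(implyP (h v)).
have := rho_nbr_neq0 T r;
  case: (pickP (rho_nbr (val T))) => [w rw _|/eq_card0 ->//].
by rewrite -(eqP (implyP (h w) rw)).
Qed.

Lemma card_rho_nbr_eq1 (T : tree) :
  (#|rho_nbr (val T)| == 1%N) = [exists r, rooted r T].
Proof.
apply/idP/existsP => [/eqP/mem_card1[r rT]|[r /rootedP rT]].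
  by exists r; apply/rootedP => v; have := rT v; rewrite !inE.
by rewrite -(card1 r); apply/eqP/eq_card => v; exact: rT.
Qed.

(** A path through rho would enter and leave it through r; so the vertices
    reached from a without using rho, together with rho itself if r is among
    them, form a connected component. *)
Lemma tree_conn_rooted r (T : tree) a b : rooted r T -> tree_conn T a b.
Proof.
move=> /rootedP rT; set c := (fun a b : V => adj (val T) (Some a) (Some b)).
have cs : connect_sym c by apply: sym_connect_sym => i j; exact: adj_sym.
pose A : pred (option V) := [pred i |
  if i is Some w then connect c a w else connect c a r].
have cl : fingraph.closed (adj (val T)) A.
  apply: (intro_closed (sym_connect_sym (adj_sym _))) => -[v|] [w|] aij;
    rewrite !inE //=.
  - by move=> cv; apply: connect_trans cv _; exact: connect1.
  - by have := rT v; rewrite /rho_nbr /= aij => /esym/eqP ->.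
  - by have := rT w; rewrite /rho_nbr /= adj_sym aij => /esym/eqP ->.
by have := closed_connect cl (connected_tree T (Some a) (Some b));
  rewrite !inE connect0 => /esym h; exact: h.
Qed.

(** The edges at rho are replaced by a single one at x; edges that avoid rho
    are kept. *)
Definition reroot_set (x : V) (T : {set {set option V}}) : {set {set option V}} :=
  ([set Some x; None] |: [set E in T | None \notin E])%SET.

Lemma adj_reroot_some x T a b :
  adj (reroot_set x T) (Some a) (Some b) = adj T (Some a) (Some b).
Proof.
rewrite /adj /reroot_set !inE; rewrite andbT orbC.
case: eqP => [/set2_inj[[]|[]] //|_]; by rewrite orbF.
Qed.

Lemma rho_nbr_reroot x T v : rho_nbr (reroot_set x T) v = (v == x).
Proof.
rewrite /rho_nbr /adj /reroot_set /= !inE orbT andbF orbF.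
apply/eqP/eqP => [/set2_inj[[[]]|[]] //|-> //].
Qed.

Lemma adj_reroot_none x T i : adj (reroot_set x T) None i = (i == Some x).
Proof.
case: i => [v|]; first by rewrite adj_sym; exact: rho_nbr_reroot.
rewrite /adj /reroot_set !inE /= andbF orbF; apply/eqP => E.
have : Some x \in [set None; None]%SET by rewrite E !inE eqxx.
by rewrite !inE.
Qed.

(** The edges of T that avoid rho already connect V, and rho is a leaf of the
    new graph: a cycle cannot pass through rho, and a cycle that avoids rho is
    a cycle of T. *)
Lemma reroot_spanning x r (T : tree) : rooted r T ->
  is_spanning_tree (ext_rel e) (reroot_set x (val T)).
Proof.
move=> rT; case/and3P: (valP T) => sub _ /asboolP ac; apply/and3P; split.
- apply/fintype.subsetP => E; rewrite /reroot_set !inE => /orP[/eqP ->|/andP[ET _]].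
    by rewrite in_edges_ext.
  by move/fintype.subsetP : sub; apply.
- have cN : connect (adj (reroot_set x (val T))) (Some x) None.
    by apply: connect1; have := rho_nbr_reroot x (val T) x; rewrite eqxx.
  apply: (@connected_to _ _ None) => [|[v|//]]; first exact: adj_sym.
  apply: connect_trans cN.
  have /connectP[p pT ->] := tree_conn_rooted v x rT.
  apply/connectP; exists (map some p); last by rewrite last_map.
  rewrite path_map; apply: sub_path pT => a b /= ab.
  by rewrite adj_reroot_some.
- apply/asboolP => c uc; rewrite leqNgt; apply/negP => sc.
  have [Nc|Nc] := boolP (None \in c).
    have [j [k [_ _ jk]]] := ucycle_pred uc Nc sc (adj_sym _).
    by rewrite !adj_reroot_none => /eqP jx /eqP kx; rewrite jx kx eqxx in jk.
  suff /ac : ucycle (adj (val T)) c by rewrite leqNgt sc.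
  move: uc; rewrite /ucycle /ucycleb => /andP[cyc ->]; rewrite andbT.
  apply: (sub_in_cycle (P := [pred i : option V | i != None])) cyc.
    move=> [a|] [b|] //= _ _; by rewrite adj_reroot_some.
  by apply/allP => i ic; apply: contraNneq Nc => <-.
Qed.

(** The default value T is returned when rerooting does not yield a spanning
    tree, which does not happen for trees attached at a single vertex. *)
Definition reroot x (T : tree) : tree := insubd T (reroot_set x (val T)).

Lemma val_reroot x r (T : tree) : rooted r T ->
  val (reroot x T) = reroot_set x (val T).
Proof. by move=> rT; rewrite val_insubd (reroot_spanning x rT). Qed.

Lemma rooted_reroot x r (T : tree) : rooted r T -> rooted x (reroot x T).
Proof.
move=> rT; apply/rootedP => v; rewrite (val_reroot x rT); exact: rho_nbr_reroot.
Qed.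

Lemma inner_edge_reroot x r (T : tree) : rooted r T ->
  inner_edge (val (reroot x T)) =1 inner_edge (val T).
Proof.
by move=> rT [a b]; rewrite (val_reroot x rT) /inner_edge /oriented_edge /=
  adj_reroot_some.
Qed.

Lemma reroot_setK r x (T : tree) : rooted r T ->
  reroot_set r (reroot_set x (val T)) = val T.
Proof.
move=> rT; apply/setP => E; rewrite /reroot_set !inE.
have rr : [set Some r; None]%SET \in val T.
  by have /rootedP/(_ r) := rT; rewrite eqxx.
apply/orP/idP => [[/eqP -> //|/andP[/orP[/eqP ->|/andP[]//]]]|ET].
  by rewrite !inE orbT.
have [i [j [ij EE]]] := spanning_treeP ext_irr (valP T) ET.
have [NE|NE] := boolP (None \in E); last by right; rewrite ET orbT.
left; have [v Ev] : exists v, E = [set Some v; None]%SET.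
  move: NE; rewrite EE !inE => /orP[]/eqP N.
    by case: j ij {EE} => [v|]; rewrite -N // => _; exists v; rewrite finset.setUC.
  by case: i ij {EE} => [v|]; rewrite -N // => _; exists v.
have /rootedP/(_ v) := rT.
by rewrite /rho_nbr /= /adj -Ev ET => /esym/eqP <-; rewrite Ev.
Qed.

Lemma reroot_inj x r : {in rooted r &, injective (reroot x)}.
Proof.
move=> T U rT rU TU; apply/val_inj.
rewrite -(reroot_setK x rT) -(reroot_setK x rU).
by rewrite -(val_reroot x rT) -(val_reroot x rU) TU.
Qed.

Lemma exists_rooted (x : V) : connected_graph e -> exists T : tree, rooted x T.
Proof.
move=> /forallP conn.
pose S : {set {set option V}} :=
  [set E in edges (ext_rel e) | (None \in E) ==> (E == [set Some x; None]%SET)]%SET.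
have adjS' a b : e a b -> adj S (Some a) (Some b).
  by move=> eab; rewrite /adj !inE /= andbT in_edges_ext.
have cS : connected_graph (adj S).
  apply: (@connected_to _ _ None) => [|[v|//]]; first exact: adj_sym.
  apply: (@connect_trans _ _ (Some x)); last first.
    by apply: connect1; rewrite /adj inE in_edges_ext eqxx implybT.
  have /connectP[p pT ->] := forallP (conn v) x.
  apply/connectP; exists (map some p); last by rewrite last_map.
  by rewrite path_map; apply: sub_path pT => a b /= ab; exact: adjS'.
have [T [TS cT aT _]] := spanning_subtree None cS.
have sT : is_spanning_tree (ext_rel e) T.
  apply/and3P; split => //; last exact/asboolP.
  by apply: fintype.subset_trans TS _; apply/fintype.subsetP => E;
    rewrite inE => /andP[].
exists (exist _ T sT); apply/forallP => v; apply/implyP;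
  rewrite /rho_nbr /= => /(adjS TS).
rewrite /adj !inE orbT /= => /andP[_ /eqP/set2_inj[[[->]]|[]]] //.
Qed.

End rooted_trees.

(** * Grounded networks *)

Section network.
Variables (R : realFieldType) (n : nat).
Implicit Types (c : 'I_n -> 'I_n -> R) (d : 'I_n -> R) (u : 'cV[R]_n).

(** The weighted Laplacian of the conductances c plus the diagonal matrix d of
    conductances to the ground. *)
Definition network_mx c d : 'M[R]_n :=
  \matrix_(i, j) if i == j then \sum_(l | l != i) c l i + d i else - c i j.

Variable c : 'I_n -> 'I_n -> R.
Hypotheses (csym : forall i j, c i j = c j i) (c0 : forall i j, 0 <= c i j).
Hypothesis cconn : forall i j, connect (fun i j => 0 < c i j) i j.

(** Stated for scaled conductances, as needed for the limit of strong
    conductances. *)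
Lemma network_mulE (a : R) d u i :
  (network_mx (fun i j => a * c i j) d *m u) i 0 =
  a * (\sum_j c i j * (u i 0 - u j 0)) + d i * u i 0.
Proof.
rewrite mxE (bigD1 i) //= mxE eqxx mulrDl addrAC; congr (_ + _).
rewrite [in RHS](bigD1 i) //= subrr mulr0 add0r mulr_suml mulr_sumr -big_split /=.
apply: eq_bigr => j ji; rewrite mxE eq_sym (negbTE ji) csym; ring.
Qed.

Lemma network_mulE1 d u i :
  (network_mx c d *m u) i 0 = \sum_j c i j * (u i 0 - u j 0) + d i * u i 0.
Proof.
rewrite -[\sum_j _]mul1r -network_mulE; congr (fun_of_matrix (_ *m _) _ _).
by apply/matrixP => k l; rewrite !mxE mul1r; under [in RHS]eq_bigr do rewrite mul1r.
Qed.

Lemma network_tr d : (network_mx c d)^T = network_mx c d.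
Proof. by apply/matrixP => i j; rewrite !mxE eq_sym; case: eqP => [->|_] //;
  rewrite csym. Qed.

Section grounded.
Variables (d : 'I_n -> R) (k : 'I_n).
Hypotheses (d0 : forall i, 0 <= d i) (dk : 0 < d k).
Local Notation M := (network_mx c d).

(** Minimum principle: at a negative minimum all terms of the equation are
    nonpositive, so they vanish. Hence the minimum is taken at all neighbours,
    thus everywhere, and then the ground conductance vanishes at k. *)
Lemma network_min u : (forall i, 0 <= (M *m u) i 0) -> forall i, 0 <= u i 0.
Proof.
move=> Mu i; have [m mP] : exists m, forall j, u m 0 <= u j 0.
  have [m _ mP] := @Order.TotalTheory.arg_minP _ _ _ k predT (fun j => u j 0) isT.
  by exists m => j; exact: mP.
apply: le_trans (mP i); rewrite leNgt; apply/negP => um0.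
have key j : u j 0 = u m 0 -> d j = 0 /\ forall l, 0 < c j l -> u l 0 = u m 0.
  move=> ujm; have := Mu j; rewrite network_mulE1 ujm => ge0.
  have t0 l : c j l * (u m 0 - u l 0) <= 0.
    by rewrite mulr_ge0_le0 // subr_le0.
  have s0 : \sum_l c j l * (u m 0 - u l 0) <= 0 by apply: sumr_le0.
  have dm0 : d j * u m 0 <= 0 by rewrite mulr_ge0_le0 // ltW.
  have se : \sum_l c j l * (u m 0 - u l 0) = 0 by lra.
  have de : d j * u m 0 = 0 by lra.
  split; first by move/eqP: de; rewrite mulf_eq0 (lt_eqF um0) orbF => /eqP.
  move=> l cjl.
  have /eqP : c j l * (u m 0 - u l 0) = 0.
    apply/eqP; rewrite eq_le t0 /=.
    have := se; rewrite (bigD1 l) //= => E.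
    have : \sum_(i0 < n | i0 != l) c j i0 * (u m 0 - u i0 0) <= 0 by apply:
      sumr_le0.
    lra.
  by rewrite mulf_eq0 (gt_eqF cjl) /= subr_eq0 => /eqP.
pose A : pred 'I_n := [pred j | u j 0 == u m 0].
have cl : fingraph.closed (fun i j => 0 < c i j) A.
  apply: intro_closed => [|j l cjl]; first by apply: sym_connect_sym => j l;
    rewrite csym.
  by rewrite !inE => /eqP /key[_ h]; rewrite h.
have := closed_connect cl (cconn m k); rewrite !inE eqxx => /esym/eqP /key[dk0 _].
by move: dk; rewrite dk0 ltxx.
Qed.

Lemma network_unit : M \in unitmx.
Proof.
rewrite -row_free_unit; apply: inj_row_free => v vM.
have Mu : M *m v^T = 0 by rewrite -network_tr -trmx_mul vM trmx0.
have h1 i : 0 <= v^T i 0 by apply: network_min => j; rewrite Mu mxE.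
have h2 i : 0 <= (- v^T) i 0 by apply: network_min => j;
  rewrite mulmxN Mu oppr0 mxE.
apply/matrixP => a b; rewrite ord1 mxE; have := h1 b; have := h2 b; rewrite !mxE;
  lra.
Qed.

Lemma network_inv_ge0 i j : 0 <= invmx M i j.
Proof.
have -> : invmx M i j = (invmx M *m delta_mx j 0 : 'cV_n) i 0 by rewrite -colE mxE.
apply: network_min => l; rewrite mulmxA mulmxV ?network_unit // mul1mx mxE.
by rewrite ler0n.
Qed.

Lemma network_inv_sym i j : invmx M i j = invmx M j i.
Proof. by rewrite -[in LHS]network_tr -trmx_inv mxE. Qed.

(** The matrix maps the constant vector 1 to d. *)
Lemma network_inv_sum i : \sum_j invmx M i j * d j = 1.
Proof.
pose one : 'cV[R]_n := const_mx 1.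
have E : invmx M *m (M *m one) = one.
  by rewrite mulmxA mulVmx ?network_unit // mul1mx.
have := congr1 (fun u : 'cV[R]_n => u i 0) E; rewrite mxE /one [RHS]mxE => <-.
apply: eq_bigr => j _; congr (_ * _); rewrite network_mulE1 !mxE mulr1.
by rewrite big1 ?add0r // => l _; rewrite !mxE subrr mulr0.
Qed.

Lemma network_inv_d_le1 i j : invmx M i j * d j <= 1.
Proof.
rewrite -(network_inv_sum i) (bigD1 j) //= lerDl; apply: sumr_ge0 => l _.
by rewrite mulr_ge0 ?network_inv_ge0.
Qed.

End grounded.

Lemma network_scale a : 0 < a ->
  forall i j, connect (fun i j => 0 < a * c i j) i j.
Proof.
move=> a0 i j; rewrite (@eq_connect _ _ (fun i j => 0 < c i j)) //.
by move=> k l; rewrite pmulr_rgt0.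
Qed.

End network.

(** Let u be the column y of the inverse. The equation says that the Laplacian
    of c maps u to r / a with |r_i| <= 1, because the currents d_i u_i to the
    ground are nonnegative with sum 1. Inverting the Laplacian grounded at k
    alone shows that u is constant up to an error of order 1 / a, and the sum
    of the currents then determines the constant. *)
Lemma network_inv_limit (R : realFieldType) n (c : 'I_n -> 'I_n -> R)
  (d : 'I_n -> R)
    (k : 'I_n) (y : 'I_n) :
  (forall i j, c i j = c j i) -> (forall i j, 0 <= c i j) ->
  (forall i j, connect (fun i j => 0 < c i j) i j) ->
  (forall i, 0 <= d i) -> 0 < d k ->
  exists C : R, forall a : R, 0 < a ->
    `|invmx (network_mx (fun i j => a * c i j) d) k y * \sum_i d i - 1| <= C / a.
Proof.
move=> cs c0 cc d0 dk; pose Q := network_mx c (fun i => (i == k)%:R).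
have Qu : Q \in unitmx.
  by apply: (network_unit cs c0 cc (k := k)) => [i|]; rewrite ?eqxx ?ltr01 // ler0n.
exists (\sum_i d i * \sum_j `|invmx Q i j|) => a a0.
set M := network_mx _ d.
have acs i j : a * c i j = a * c j i by rewrite cs.
have ac0 i j : 0 <= a * c i j by rewrite mulr_ge0 // ltW.
have acc := network_scale cc a0.
pose u : 'cV[R]_n := col y (invmx M).
have Mu : M *m u = delta_mx y 0.
  by rewrite /u colE mulmxA mulmxV ?mul1mx // (network_unit acs ac0 acc d0 dk).
have u0 i : 0 <= u i 0 by rewrite mxE (network_inv_ge0 acs ac0 acc d0 dk).
have du : \sum_i d i * u i 0 = 1.
  rewrite -(network_inv_sum acs ac0 acc d0 dk y); apply: eq_bigr => i _.
  by rewrite mulrC mxE (network_inv_sym acs).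
have du1 i : 0 <= d i * u i 0 <= 1.
  rewrite mulr_ge0 //= -du (bigD1 i) //= lerDl; apply: sumr_ge0 => j _.
  by rewrite mulr_ge0.
have -> : invmx M k y = u k 0 by rewrite mxE.
clearbody u.
pose w : 'cV[R]_n := \col_i (u i 0 - u k 0).
pose r : 'cV[R]_n := \col_i ((i == y)%:R - d i * u i 0).
have Qw : Q *m w = a^-1 *: r.
  apply/matrixP => i j; rewrite ord1 network_mulE1 // !mxE.
  have := congr1 (fun u : 'cV[R]_n => u i 0) Mu;
    rewrite /M network_mulE // !mxE andbT => E.
  have -> : (i == k)%:R * (u i 0 - u k 0) = 0.
    by case: eqP => [->|_]; rewrite ?subrr ?mulr0 ?mul0r.
  rewrite (eq_bigr (fun l => c i l * (u i 0 - u l 0))); last first.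
    by move=> l _; rewrite !mxE; ring.
  by rewrite addr0 -E addrK mulKf // gt_eqF.
have wE : w = a^-1 *: (invmx Q *m r).
  by rewrite scalemxAr -Qw mulmxA mulVmx // mul1mx.
have r1 j : `|r j 0| <= 1.
  rewrite mxE ler_norml; have /andP[? ?] := du1 j.
  by case: (j == y) => /=; apply/andP; split; lra.
have wle i : `|w i 0| <= (\sum_j `|invmx Q i j|) / a.
  rewrite wE mxE normrM gtr0_norm ?invr_gt0 // [leRHS]mulrC.
  rewrite ler_pM2l ?invr_gt0 // mxE (le_trans (ler_norm_sum _ _ _)) //.
  apply: ler_sum => j _; rewrite normrM ler_piMr //.
have -> : u k 0 * \sum_i d i - 1 = - \sum_i d i * w i 0.
  rewrite -du mulr_sumr -sumrB -sumrN; apply: eq_bigr => i _; rewrite !mxE; ring.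
rewrite normrN (le_trans (ler_norm_sum _ _ _)) // mulr_suml.
apply: ler_sum => i _; rewrite normrM (ger0_norm (d0 i)) -mulrA.
by rewrite ler_wpM2l.
Qed.

(** * Zooming into the region charged by weak pinning *)

Section coordinates.
Variables (R : realType) (V : finType) (e : rel V) (beta : V -> V -> R).
Hypotheses (es : symmetric e) (ei : irreflexive e).
Local Notation RV := (RV R V).
Local Notation tree := (spanning_tree e).
Local Notation all_edges := (edges (ext_rel e)).

Lemma cosh_sym (a b : R) : cosh (a - b) = cosh (b - a).
Proof. by rewrite /cosh !opprB addrC. Qed.

Lemma B_sym (t s : RV) i j : B t s i j = B t s j i.
Proof. by rewrite /B cosh_sym; congr (_ + _ * expR _ / _); ring. Qed.

Lemma rho_nbr_all v : rho_nbr all_edges v.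
Proof. by rewrite /rho_nbr /= (adj_edges (ext_sym es)). Qed.

Lemma inner_edge_all p : inner_edge all_edges p =
  (enum_rank (Some p.1) < enum_rank (Some p.2))%N && e p.1 p.2.
Proof. by rewrite /inner_edge /oriented_edge /= (adj_edges (ext_sym es)). Qed.

Lemma densityE (eps : V -> R) (t s : RV) (T : tree) :
  density beta eps (t, s, T) =
  (\prod_(j : V) (expR (- coord t (Some j)) / (2 * pi))) *
  ((\prod_i expR (- (eps i * (cosh (coord t (Some i)) +
       coord s (Some i) ^+ 2 * expR (coord t (Some i)) / 2 - 1)))) *
   \prod_(p | inner_edge all_edges p)
     expR (- (beta p.1 p.2 * (B t s (Some p.1) (Some p.2) - 1)))) *
  ((\prod_(v | rho_nbr (val T) v) (eps v * expR (coord t (Some v)))) *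
   \prod_(p | inner_edge (val T) p)
     (beta p.1 p.2 * expR (coord t (Some p.1) + coord t (Some p.2)))).
Proof.
rewrite /density /=; congr (_ * _ * _).
  rewrite [LHS](@big_oriented_edge V R 1 *%R _
    (fun i j => expR (- (weight beta eps i j * (B t s i j - 1))))); last first.
    by move=> v /=; rewrite B_sym.
  congr (_ * _); rewrite (eq_bigl xpredT); last by move=> v; rewrite rho_nbr_all.
  by apply: eq_bigr => v _; rewrite /= /B /= !subr0 addr0.
rewrite [LHS](@big_oriented_edge V R 1 *%R _
  (fun i j => weight beta eps i j * expR (coord t i + coord t j))); last first.
  by move=> v /=; rewrite addrC.
by congr (_ * _); apply: eq_bigr => v _; rewrite /= addr0.
Qed.

Variables (x : V) (q : V -> R).
Hypotheses (q0 : forall i, 0 <= q i) (qx : 0 < q x).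
Local Notation k := (enum_rank x).
Local Notation N := #|V|.

Definition rel_coord (t : RV) (i : V) : R :=
  if i == x then 0 else tnth t (enum_rank i).

Lemma rel_coordx t : rel_coord t x = 0. Proof. by rewrite /rel_coord eqxx. Qed.

(** The total pinning weight seen from x, in units of e^(t_x). *)
Definition mass (t : RV) : R := \sum_i q i * expR (rel_coord t i).

Lemma mass_ge t : q x <= mass t.
Proof.
rewrite /mass (bigD1 x) //= rel_coordx expR0 mulr1 lerDl; apply: sumr_ge0 => i _.
by rewrite mulr_ge0 // expR_ge0.
Qed.

Lemma mass_gt0 t : 0 < mass t. Proof. exact: lt_le_trans (mass_ge t). Qed.

(** The value of r e^(t_x) in the zoomed coordinates; it does not depend on r. *)
Definition height (z : RV * RV) : R :=
  expR (tnth z.1 k) / ((1 + tnth z.2 k ^+ 2) * mass z.1).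

Lemma oneD_gt0 (a : R) : 0 < 1 + a ^+ 2.
Proof. by have := sqr_ge0 a; lra. Qed.

Lemma height_gt0 z : 0 < height z.
Proof. by rewrite divr_gt0 ?expR_gt0 // mulr_gt0 ?oneD_gt0 ?mass_gt0. Qed.

(** The first term follows the mass as r tends to 0, the other two make the
    limit of the pinning factor depend on the coordinate of t at x alone. *)
Definition zoom_shift (r : R) (z : RV * RV) : R :=
  - ln r - ln (1 + tnth z.2 k ^+ 2) - ln (mass z.1).

(** The differences of s are expanded by e^(- t_x), which makes the bond terms
    independent of t_x. *)
Definition zoom (r : R) : RV * RV -> RV * RV :=
  shear_pair k (fun u => expR (- u)) (zoom_shift r).

Lemma zoom1 r z i : 0 < r -> coord (zoom r z).1 (Some i) =
  tnth z.1 k + zoom_shift r z + rel_coord z.1 i.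
Proof.
move=> r0; rewrite /zoom /shear_pair /= tnth_mktuple (inj_eq enum_rank_inj)
  /rel_coord.
by case: (i == x); rewrite ?addr0 // mul1r addrC; case: z.
Qed.

Lemma expR_zoom1 r z i : 0 < r ->
  expR (coord (zoom r z).1 (Some i)) = height z / r * expR (rel_coord z.1 i).
Proof.
move=> r0; rewrite zoom1 // !expRD; congr (_ * _).
rewrite !expRN !lnK ?posrE ?oneD_gt0 ?mass_gt0 // /height.
field; rewrite !gt_eqF ?oneD_gt0 ?mass_gt0 //.
Qed.

Lemma zoom2 r z i : 0 < r -> coord (zoom r z).2 (Some i) =
  tnth z.2 k + r / height z * rel_coord z.2 i.
Proof.
move=> r0; have h0 := height_gt0 z.
rewrite /zoom /shear_pair /= tnth_mktuple (inj_eq enum_rank_inj) /rel_coord !addr0.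
case: eqP => [_|_]; first by rewrite mulr0 addr0.
have := expR_zoom1 z x r0; rewrite rel_coordx expR0 mulr1 /zoom /shear_pair /= => E.
by rewrite expRN E invf_div addrC.
Qed.

Definition base (z : RV * RV) : R :=
  (\prod_(j : V) (expR (- rel_coord z.1 j) / (2 * pi))) *
  \prod_(p | inner_edge all_edges p)
     expR (- (beta p.1 p.2 * (cosh (rel_coord z.1 p.1 - rel_coord z.1 p.2) +
       (rel_coord z.2 p.1 - rel_coord z.2 p.2) ^+ 2 * expR
         (rel_coord z.1 p.1 + rel_coord z.1 p.2) / 2 - 1))).

Definition pinning (r : R) (z : RV * RV) : R :=
  \prod_i expR (- (q i * (height z * expR (rel_coord z.1 i) *
     (1 + (tnth z.2 k + r / height z * rel_coord z.2 i) ^+ 2) / 2 +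
     r ^+ 2 / (height z * expR (rel_coord z.1 i)) / 2 - r))).

Definition inner_weight (T : tree) (t : RV) : R :=
  \prod_(p | inner_edge (val T) p)
    (beta p.1 p.2 * expR (rel_coord t p.1 + rel_coord t p.2)).

Definition tree_weight (T : tree) (t : RV) : R :=
  (\prod_(v | rho_nbr (val T) v) (q v * expR (rel_coord t v))) * inner_weight T t.

(** Every power of r is collected here. The factors e^(- t_j) and the Jacobian
    give (r / h)^(2 N - 1), with h the height; an edge of T inside the graph
    gives (h / r)^2 and an edge at rho gives h. As T has N edges, what remains
    is (r^2 / h)^(k - 1) times r, with k edges at rho. *)
Lemma zoom_density (r f : R) z (T : tree) : 0 < r ->
  expR (- tnth (zoom r z).1 k) ^+ N.-1 *
    (f * density beta (fun i => q i * r) (zoom r z, T)) =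
  base z * pinning r z * tree_weight T z.1 *
  (r ^+ 2 / height z) ^+ (#|rho_nbr (val T)|.-1) * (r * f).
Proof.
move=> r0; have h0 := height_gt0 z.
rewrite /base /pinning; set h := height z in h0 *.
have [t [s [-> e1 s2 d1]]] : exists t s, [/\ zoom r z = (t, s),
    forall i, expR (coord t (Some i)) = h / r * expR (rel_coord z.1 i),
    forall i, coord s (Some i) = tnth z.2 k + r / h * rel_coord z.2 i &
    forall i j, coord t (Some i) - coord t (Some j) =
      rel_coord z.1 i - rel_coord z.1 j].
  exists (zoom r z).1, (zoom r z).2; split.
  - by case: (zoom r z).
  - by move=> i; exact: expR_zoom1.
  - by move=> i; exact: zoom2.
  - by move=> i j; rewrite !zoom1 //; ring.
rewrite [(t, s).1]/=.
have rn0 : r != 0 by rewrite gt_eqF.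
have hn0 : h != 0 by rewrite gt_eqF.
have -> : expR (- tnth t k) = r / h.
  by rewrite -[tnth _ k]/(coord t (Some x)) expRN e1 rel_coordx expR0 mulr1
    invf_div.
rewrite densityE.
rewrite (eq_bigr (fun j : V => (r / h) * (expR (- rel_coord z.1 j) / (2 * pi))));
  last first.
  by move=> j _; rewrite expRN e1 invfM invf_div -expRN mulrA.
rewrite big_split prodr_const.
rewrite [X in _ * (f * (_ * (X * _) * _))](eq_bigr
  (fun i => expR (- (q i * (h * expR (rel_coord z.1 i) *
     (1 + (tnth z.2 k + r / h * rel_coord z.2 i) ^+ 2) / 2 +
     r ^+ 2 / (h * expR (rel_coord z.1 i)) / 2 - r))))); last first.
  move=> i _; congr (expR (- _)); rewrite -mulrA; congr (_ * _).
  rewrite /Defs.cosh expRN e1 s2.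
  by field; rewrite rn0 hn0 gt_eqF ?expR_gt0.
set P := \prod_i expR (- (q i * _)).
rewrite [X in _ * (f * (_ * (_ * X) * _))](eq_bigr (fun p : V * V =>
   expR (- (beta p.1 p.2 * (cosh (rel_coord z.1 p.1 - rel_coord z.1 p.2) +
       (rel_coord z.2 p.1 - rel_coord z.2 p.2) ^+ 2 * expR
         (rel_coord z.1 p.1 + rel_coord z.1 p.2) / 2 - 1))))); last first.
  move=> p _; congr (expR (- (_ * (_ - 1)))); rewrite /B d1; congr (_ + _).
  by rewrite !expRD !e1 !s2; field; rewrite rn0 hn0.
set A2 := \prod_(i | inner_edge all_edges i) _.
rewrite [X in _ * (f * (_ * (X * _)))](eq_bigr
  (fun v => h * (q v * expR (rel_coord z.1 v)))); last first.
  by move=> v _; rewrite e1; field.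
rewrite [X in _ * (f * (_ * (_ * X)))](eq_bigr
  (fun p : V * V => (h / r) ^+ 2 *
    (beta p.1 p.2 * expR (rel_coord z.1 p.1 + rel_coord z.1 p.2)))); last first.
  by move=> p _; rewrite !expRD !e1; field.
rewrite [X in _ * (f * (_ * (X * _)))]big_split
  [X in _ * (f * (_ * (_ * X)))]big_split.
rewrite !prodr_const /=.
rewrite /tree_weight /inner_weight.
have cT := card_tree ei T; have r1 := rho_nbr_neq0 T x.
set m := #|rho_nbr (val T)| in cT r1 *; set l := #|inner_edge (val T)| in cT *.
set A1 := \prod_(i : V) (_ / _).
set A3 := \prod_(i | rho_nbr _ i) _; set A4 := \prod_(i | inner_edge (val T) i) _.
clearbody h.
have key : (r / h) ^+ N.-1 * ((r / h) ^+ N * (h ^+ m * ((h / r) ^+ 2) ^+ l)) =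
    (r ^+ 2 / h) ^+ m.-1 * r.
  rewrite -cT -(prednK r1); move: (m.-1) => m'.
  have hrE : h / r = (r / h)^-1 by rewrite invf_div.
  have rE : r ^+ 2 / h = (r / h) ^+ 2 * h by field.
  have rE' : r = r / h * h by rewrite mulfVK.
  have a0 : r / h != 0 by rewrite mulf_neq0 // invr_eq0.
  rewrite hrE rE [X in _ = _ * X]rE'; move: (r / h) a0 => a a0.
  have L0 : a ^+ l != 0 by rewrite expf_neq0.
  rewrite addSn -!pred_Sn !exprS !exprD !expr0 !mulr1 ![in RHS]exprMn
    [(a^-1 * a^-1) ^+ l]exprMn exprVn.
  move: (a ^+ l) L0 => L L0; move: (a ^+ m') (h ^+ m') => A H.
  by field.
have gather (a b c d A1' P' A2' A3' A4' K : R) : a * (b * (c * d)) = K * r ->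
    a * (f * (b * A1' * (P' * A2') * (c * A3' * (d * A4')))) =
    A1' * A2' * P' * (A3' * A4') * K * (r * f).
  move=> E; transitivity (a * (b * (c * d)) * (f * A1' * P' * A2' * A3' * A4')).
    by ring.
  by rewrite E; ring.
exact: gather key.
Qed.

End coordinates.

(** * Elementary inequalities *)

Section elementary.
Variable R : realType.

(** From 1 + w <= e^w at w = c u / (n + 1), raised to the power n. *)
Lemma oneDX_le_expR (c : R) n : 0 < c ->
  exists2 C : R, 0 <= C & forall u, 0 <= u -> (1 + u) ^+ n <= C * expR (c * u).
Proof.
move=> c0; exists ((1 + n.+1%:R / c) ^+ n) => [|u u0].
  by rewrite exprn_ge0 // addr_ge0 // divr_ge0 // ltW.
have n0 : 0 < n.+1%:R :> R by rewrite ltr0n.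
have nc : 0 < n.+1%:R / c by rewrite divr_gt0.
have h : 1 + u <= (1 + n.+1%:R / c) * expR (c * u / n.+1%:R).
  apply: (@le_trans _ _ ((1 + n.+1%:R / c) * (1 + c * u / n.+1%:R))); last first.
    by rewrite ler_pM2l ?expR_ge1Dx //; lra.
  have -> : (1 + n.+1%:R / c) * (1 + c * u / n.+1%:R) =
      1 + u + (n.+1%:R / c + c * u / n.+1%:R).
    by move: (n.+1%:R) n0 nc => m n0 nc; field; rewrite !gt_eqF.
  by rewrite lerDl addr_ge0 ?(ltW nc) // divr_ge0 ?(ltW n0) // mulr_ge0 // ltW.
have u1 : 0 <= 1 + u by lra.
have := lerXn2r n u1 (le_trans u1 h) h; rewrite exprMn => /le_trans; apply.
rewrite ler_wpM2l ?exprn_ge0 //; first lra.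
rewrite -expRM_natl ler_expR mulrA ler_pdivrMr // [leRHS]mulrC.
by rewrite ler_wpM2r ?ler_nat // mulr_ge0 // ltW.
Qed.

Lemma oneDsqr_le_expR (u : R) : 1 + u ^+ 2 <= 4 * (expR u + expR (- u)).
Proof.
have h (w : R) : 0 <= w -> 1 + w ^+ 2 <= 4 * expR w.
  move=> w0; have := expR_ge1Dx (w / 2) => e1.
  have -> : expR w = expR (w / 2) ^+ 2 by rewrite -expRM_natl; congr expR; field.
  have e0 : 0 <= 1 + w / 2 by lra.
  have : (1 + w / 2) ^+ 2 <= expR (w / 2) ^+ 2 by rewrite ler_sqr ?nnegrE //
    (le_trans e0).
  nra.
have [u0|u0] := leP 0 u.
  by have := h _ u0; have := expR_ge0 (- u); lra.
have : 0 <= - u by lra.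
by move=> /h; rewrite sqrrN; have := expR_ge0 u; lra.
Qed.

(** With cosh u - 1 = (e^(u/2) - e^(-u/2))^2 / 2. The constant is not the best
    one; only quadratic growth matters. *)
Lemma cosh_ge (u : R) : 1 + u ^+ 2 / 8 <= cosh u.
Proof.
rewrite /Defs.cosh.
have E : expR u = expR (u / 2) ^+ 2 by rewrite -expRM_natl; congr expR; field.
have E' : expR (- u) = expR (- (u / 2)) ^+ 2 by rewrite -expRM_natl; congr expR;
  field.
have P : expR (u / 2) * expR (- (u / 2)) = 1 by rewrite -expRD subrr expR0.
have h (w : R) : 0 <= w -> w <= expR w - expR (- w).
  move=> w0; have := expR_ge1Dx w;
    have : expR (- w) <= 1 by rewrite -expR0 ler_expR oppr_le0.
  lra.
have : (u / 2) ^+ 2 <= (expR (u / 2) - expR (- (u / 2))) ^+ 2.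
  have [u0|u0] := leP 0 u.
    have u2 : 0 <= u / 2 by lra.
    by have := h _ u2 => hh; rewrite ler_sqr ?nnegrE //; lra.
  rewrite -sqrrN -[leRHS]sqrrN opprB.
  have u2 : 0 <= - (u / 2) by lra.
  have := h _ u2; rewrite opprK => hh.
  by rewrite ler_sqr ?nnegrE //; lra.
rewrite E E'; nra.
Qed.

Lemma oneDX_expRN_bounded (c : R) n : 0 < c ->
  exists2 C : R, 0 <= C & forall u, 0 <= u -> (1 + u) ^+ n * expR (- (c * u)) <= C.
Proof.
move=> c0; have [C C0 h] := oneDX_le_expR n c0; exists C => // u u0.
by rewrite expRN ler_pdivrMr ?expR_gt0 //; exact: h.
Qed.

End elementary.

(** * Decay of the bond weights *)

Section domination.
Variables (R : realType) (V : finType) (e : rel V) (beta : V -> V -> R).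
Hypotheses (es : symmetric e) (ei : irreflexive e).
Hypotheses (econn : connected_graph e) (b0 : forall i j, e i j -> 0 < beta i j).
Variables (x : V).
Local Notation RV := (RV R V).
Local Notation tree := (spanning_tree e).
Local Notation all_edges := (edges (ext_rel e)).
Local Notation k := (enum_rank x).
Local Notation N := #|V|.
Local Notation rc := (rel_coord x).

Lemma inner_edge_rel p : inner_edge all_edges p -> e p.1 p.2.
Proof. by rewrite (inner_edge_all es) => /andP[]. Qed.

Definition variation (g : V -> R) : R :=
  \sum_(p | inner_edge all_edges p) `|g p.1 - g p.2|.

Lemma variation_ge0 g : 0 <= variation g. Proof. by apply: sumr_ge0. Qed.

Lemma le_variation g i j : e i j -> `|g i - g j| <= variation g.
Proof.
have h a b : inner_edge all_edges (a, b) -> `|g a - g b| <= variation g.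
  by move=> ab; rewrite /variation (bigD1 (a, b)) //= lerDl sumr_ge0.
move=> eij; have : enum_rank (Some i) != enum_rank (Some j) :> nat.
  rewrite (inj_eq val_inj) (inj_eq enum_rank_inj); apply: contraTneq eij => -[->].
  by rewrite ei.
rewrite neq_ltn => /orP[lt|lt]; first by apply: h; rewrite (inner_edge_all es) lt.
by rewrite distrC; apply: h; rewrite (inner_edge_all es) lt es.
Qed.

(** A simple path from x to i has fewer than #|V| edges, and each of them
    costs at most the total variation. *)
Lemma norm_le_variation g i : g x = 0 -> `|g i| <= N%:R * variation g.
Proof.
move=> gx; have /connectP[p0 p0e ->] := forallP (forallP econn x) i.
case/shortenP: p0e => p pe up _.
have h (a : V) (s : seq V) : path e a s ->
  `|g (last a s)| <= `|g a| + (size s)%:R * variation g.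
  elim: s a => [|b s IHs] a /=; first by rewrite mul0r addr0.
  move=> /andP[eab /IHs h]; apply: (le_trans h).
  rewrite -natr1 mulrDl mul1r (addrC _ (variation g)) addrA lerD2r.
  have : `|g b| <= `|g a| + `|g a - g b|.
    by rewrite -[X in `|X| <= _](subKr (g a)) ler_normB.
  by move=> /le_trans; apply; rewrite lerD2l le_variation.
apply: le_trans (h _ _ pe) _;
  rewrite gx normr0 add0r ler_wpM2r ?variation_ge0 // ler_nat.
have /card_uniqP := up; rewrite /= => sp.
by have := max_card (mem (x :: p)); rewrite sp; apply: leq_trans.
Qed.

(** A bound for all differences t_i - t_x, built from the differences along
    edges that the bond weights control. *)
Definition spread (v : RV) : R := N%:R * variation (rc v).

Lemma spread_ge0 v : 0 <= spread v.
Proof. by rewrite mulr_ge0 // variation_ge0. Qed.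

Lemma norm_rc v i : `|rc v i| <= spread v.
Proof. by apply: norm_le_variation; exact: rel_coordx. Qed.

(** The class of nonnegative functions of the differences of t that the bond
    weights can absorb. *)
Definition exptype (F : RV -> R) := exists C K : R, [/\ 0 <= C, 0 <= K &
  forall v, 0 <= F v <= C * expR (K * spread v)].

Lemma exptype_cst c : 0 <= c -> exptype (fun=> c).
Proof.
by move=> c0; exists c, 0; split => // v; rewrite mul0r expR0 mulr1 c0 lexx.
Qed.

Lemma exptypeM F G : exptype F -> exptype G -> exptype (fun v => F v * G v).
Proof.
move=> [C [K [C0 K0 h]]] [D [L [D0 L0 g]]]; exists (C * D), (K + L).
split; [exact: mulr_ge0|exact: addr_ge0|move=> v].
have /andP[F0 Fle] := h v; have /andP[G0 Gle] := g v.
rewrite mulr_ge0 //= mulrDl expRD mulrACA; exact: ler_pM.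
Qed.

Lemma exptypeD F G : exptype F -> exptype G -> exptype (fun v => F v + G v).
Proof.
move=> [C [K [C0 K0 h]]] [D [L [D0 L0 g]]]; exists (C + D), (K + L).
split; [exact: addr_ge0|exact: addr_ge0|move=> v].
have /andP[F0 Fle] := h v; have /andP[G0 Gle] := g v.
rewrite addr_ge0 //= mulrDl lerD //.
  by apply: (le_trans Fle);
    rewrite ler_wpM2l // ler_expR mulrDl lerDl mulr_ge0 // spread_ge0.
by apply: (le_trans Gle);
  rewrite ler_wpM2l // ler_expR mulrDl lerDr mulr_ge0 // spread_ge0.
Qed.

Lemma exptype_prod (I : finType) (P : pred I) (F : I -> RV -> R) :
  (forall i, P i -> exptype (F i)) -> exptype (fun v => \prod_(i | P i) F i v).
Proof.
move=> h; rewrite /index_enum; elim: (Finite.enum _) => [|i s IHs].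
  rewrite (_ : (fun v => _) = fun=> 1); first by apply: exptype_cst.
  by apply/funext => v; rewrite big_nil.
have [Pi|Pi] := boolP (P i); last first.
  rewrite (_ : (fun v => _) = fun v => \prod_(j <- s | P j) F j v) //.
  by apply/funext => v; rewrite big_cons (negbTE Pi).
rewrite (_ : (fun v => _) = fun v => F i v * \prod_(j <- s | P j) F j v).
  by apply: exptypeM => //; exact: h.
by apply/funext => v; rewrite big_cons Pi.
Qed.

Lemma exptype_sum (I : finType) (P : pred I) (F : I -> RV -> R) :
  (forall i, P i -> exptype (F i)) -> exptype (fun v => \sum_(i | P i) F i v).
Proof.
move=> h; rewrite /index_enum; elim: (Finite.enum _) => [|i s IHs].
  rewrite (_ : (fun v => _) = fun=> 0); first by apply: exptype_cst.
  by apply/funext => v; rewrite big_nil.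
have [Pi|Pi] := boolP (P i); last first.
  rewrite (_ : (fun v => _) = fun v => \sum_(j <- s | P j) F j v) //.
  by apply/funext => v; rewrite big_cons (negbTE Pi).
rewrite (_ : (fun v => _) = fun v => F i v + \sum_(j <- s | P j) F j v).
  by apply: exptypeD => //; exact: h.
by apply/funext => v; rewrite big_cons Pi.
Qed.

Lemma exptype_expR i : exptype (fun v => expR (rc v i)).
Proof.
exists 1, 1; split => // v; rewrite expR_ge0 /= !mul1r ler_expR.
exact: le_trans (ler_norm _) (norm_rc _ _).
Qed.

Lemma exptype_expRN i : exptype (fun v => expR (- rc v i)).
Proof.
exists 1, 1; split => // v; rewrite expR_ge0 /= !mul1r ler_expR.
by apply: le_trans (norm_rc _ i); rewrite -normrN ler_norm.
Qed.

Definition bond_weight (z : RV * RV) : R :=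
  \prod_(p | inner_edge all_edges p)
     expR (- (beta p.1 p.2 * (cosh (rc z.1 p.1 - rc z.1 p.2) +
       (rc z.2 p.1 - rc z.2 p.2) ^+ 2 * expR (rc z.1 p.1 + rc z.1 p.2) / 2 - 1))).

Definition dirichlet_form (s : RV) : R :=
  \sum_(p | inner_edge all_edges p) beta p.1 p.2 * (rc s p.1 - rc s p.2) ^+ 2 / 2.

Lemma dirichlet_form_ge0 s : 0 <= dirichlet_form s.
Proof.
apply: sumr_ge0 => p /inner_edge_rel/b0 bp.
by rewrite divr_ge0 // mulr_ge0 ?sqr_ge0 // ltW.
Qed.

(** Per edge, a quadratic lower bound of the hyperbolic cosine beats the
    linear function with any slope, up to a constant; the exponential in front
    of the square of the difference of s is at least e^(- 2 spread). *)
Lemma bond_weight_le (L : R) : exists2 C : R, 0 <= C &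
  forall z, bond_weight z <=
    C * expR (- (L * spread z.1)) * expR
      (- (expR (- (2 * spread z.1)) * dirichlet_form z.2)).
Proof.
pose L' := L * N%:R.
pose C := \sum_(p | inner_edge all_edges p) 2 * L' ^+ 2 / beta p.1 p.2.
exists (expR C) => [|z]; first exact: expR_ge0.
set m := spread z.1; set E := expR (- (2 * m)).
rewrite /bond_weight -expR_sum -!expRD ler_expR.
suff : L * m + E * dirichlet_form z.2 <= C + \sum_(p | inner_edge all_edges p)
    beta p.1 p.2 * (cosh (rc z.1 p.1 - rc z.1 p.2) +
       (rc z.2 p.1 - rc z.2 p.2) ^+ 2 * expR (rc z.1 p.1 + rc z.1 p.2) / 2 - 1).
  by rewrite sumrN; lra.
have -> : L * m = \sum_(p | inner_edge all_edges p) L' * `|rc z.1 p.1 - rc z.1 p.2|.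
  by rewrite /m /spread mulrA mulr_sumr.
rewrite /dirichlet_form mulr_sumr /C -!big_split /=;
  apply: ler_sum => p /inner_edge_rel/b0 bp.
set d := rc z.1 p.1 - rc z.1 p.2; set D := rc z.2 p.1 - rc z.2 p.2.
have hE : E <= expR (rc z.1 p.1 + rc z.1 p.2).
  rewrite ler_expR; have := norm_rc z.1 p.1; have := norm_rc z.1 p.2.
  by rewrite !ler_norml -/m => /andP[? ?] /andP[? ?]; lra.
have h1 : E * (beta p.1 p.2 * D ^+ 2 / 2) <=
    beta p.1 p.2 * (D ^+ 2 * expR (rc z.1 p.1 + rc z.1 p.2) / 2).
  rewrite [leLHS](_ : _ = beta p.1 p.2 * D ^+ 2 / 2 * E); last by ring.
  rewrite [leRHS](_ : _ = beta p.1 p.2 * D ^+ 2 / 2 * expR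
    (rc z.1 p.1 + rc z.1 p.2)); last by ring.
  by rewrite ler_wpM2l // divr_ge0 // mulr_ge0 ?sqr_ge0 // ltW.
have h2 : L' * `|d| <= 2 * L' ^+ 2 / beta p.1 p.2 + beta p.1 p.2 * (d ^+ 2 / 8).
  rewrite -subr_ge0 (_ : _ - _ =
    beta p.1 p.2 / 8 * (`|d| - 4 * L' / beta p.1 p.2) ^+ 2).
    by rewrite mulr_ge0 ?sqr_ge0 // divr_ge0 // ltW.
  rewrite -[d ^+ 2]real_normK ?num_real //; by field; rewrite gt_eqF.
have h3 : beta p.1 p.2 * (d ^+ 2 / 8) <= beta p.1 p.2 * (cosh d - 1).
  by rewrite ler_pM2l //; have := cosh_ge d; lra.
have -> : beta p.1 p.2 * (cosh d + D ^+ 2 * expR (rc z.1 p.1 + rc z.1 p.2) / 2 - 1)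
  =
  beta p.1 p.2 * (cosh d - 1) + beta p.1 p.2 *
    (D ^+ 2 * expR (rc z.1 p.1 + rc z.1 p.2) / 2).
  by ring.
lra.
Qed.

(** The vertex x is left out: its two coordinates are controlled by the
    pinning. *)
Definition off_bell (t : RV) : R := \prod_(j | j != k) bell (tnth t j).

Lemma off_bell_gt0 t : 0 < off_bell t.
Proof. by apply: prodr_gt0 => j _; exact: bell_gt0. Qed.

Lemma bell_prodE (t : RV) : bell_prod t = bell (tnth t k) * off_bell t.
Proof. by rewrite /bell_prod (bigD1 k). Qed.

Lemma bell_ge (u a : R) : `|u| <= a -> 1 <= bell u * (1 + a) ^+ 2.
Proof.
move=> ua; rewrite /bell mulrC ler_pdivlMr ?oneD_gt0 // mul1r -real_normK ?num_real
  //.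
have := normr_ge0 u; nra.
Qed.

Lemma off_bell_ge (t : RV) (a : R) : 0 <= a -> (forall i, `|rc t i| <= a) ->
  1 <= off_bell t * (1 + a) ^+ (2 * N).
Proof.
move=> a0 ta.
have a1 : 1 <= 1 + a by lra.
apply: (@le_trans _ _ (\prod_(j < N | j != k) (bell (tnth t j) * (1 + a) ^+ 2))).
  rewrite [leLHS](_ : 1 = \prod_(j < N | j != k) 1); last by rewrite big1.
  apply: ler_prod => j jk; rewrite ler01 /=; apply: bell_ge.
  have := ta (enum_val j); rewrite /rel_coord enum_valK.
  case: eqP => // jx; by rewrite -jx enum_valK eqxx in jk.
rewrite big_split /= ler_wpM2l ?(ltW (off_bell_gt0 t)) //.
rewrite prodr_const -exprM ler_weXn2l // leq_mul2l /=.
by apply: leq_trans (max_card _) _; rewrite card_ord.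
Qed.

(** The inverse of the product of Cauchy densities is polynomial in the spread
    and in the Dirichlet form. The former is absorbed by the slope at our
    disposal in [bond_weight_le], the latter by the exponential of the
    Dirichlet form after the loss of a factor e^(2 spread) for each power. *)
Lemma bond_weight_dominated (K : R) : 0 <= K -> exists2 C : R, 0 <= C &
  forall z, bond_weight z * expR (K * spread z.1) <= C *
    (off_bell z.1 * off_bell z.2).
Proof.
move=> K0.
pose C1 := \sum_(p | inner_edge all_edges p) (1 + 2 / beta p.1 p.2).
have C10 : 0 <= C1.
  apply: sumr_ge0 => p /inner_edge_rel/b0 bp; rewrite addr_ge0 // divr_ge0 //;
    exact: ltW.
have [Cv Cv0 hv] := oneDX_le_expR (2 * N) (@ltr01 R).
have [Cs Cs0 hs] := oneDX_expRN_bounded (2 * N) (@ltr01 R).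
(* K for the given factor, 1 for the polynomial in the spread, and 2 for each of
   the 2 N powers of the Dirichlet form *)
pose L := K + 1 + 2 * (2 * N)%:R.
have [Cb Cb0 hb] := bond_weight_le L.
pose D := (1 + N%:R * C1) ^+ (2 * N).
have D0 : 0 <= D by rewrite exprn_ge0 // addr_ge0 // mulr_ge0.
exists (Cb * Cv * (D * Cs)) => [|z]; first by rewrite !mulr_ge0.
set m := spread z.1; set E := expR (- (2 * m)); set Q := dirichlet_form z.2.
have m0 : 0 <= m by exact: spread_ge0.
have Q0 : 0 <= Q by exact: dirichlet_form_ge0.
have E0 : 0 <= E by exact: expR_ge0.
have EQ0 : 0 <= E * Q by exact: mulr_ge0.
have ed : variation (rc z.2) <= C1 * (1 + Q).
  rewrite /variation /C1 mulr_suml; apply: ler_sum => p pe;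
    have bp := b0 (inner_edge_rel pe).
  set d := rc z.2 p.1 - rc z.2 p.2.
  have dQ : d ^+ 2 <= 2 / beta p.1 p.2 * Q.
    rewrite mulrC mulrA ler_pdivlMr // mulrC.
    have : beta p.1 p.2 * d ^+ 2 / 2 <= Q.
      rewrite /Q /dirichlet_form (bigD1 p) //= lerDl;
        apply: sumr_ge0 => p' /andP[/inner_edge_rel/b0 bp' _].
      by rewrite divr_ge0 // mulr_ge0 ?sqr_ge0 // ltW.
    lra.
  have b2 : 0 <= 2 / beta p.1 p.2 by rewrite divr_ge0 // ltW.
  have d1 : `|d| <= 1 + d ^+ 2 by rewrite -real_normK ?num_real //;
    have := normr_ge0 d; nra.
  rewrite mulrDl mul1r; nra.
pose Y := N%:R * C1 * (1 + Q).
have Y0 : 0 <= Y by rewrite !mulr_ge0 // addr_ge0.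
have sY i : `|rc z.2 i| <= Y.
  apply: (le_trans (norm_le_variation _ (rel_coordx _ _))).
  by rewrite /Y -mulrA ler_wpM2l.
have os := off_bell_ge Y0 sY.
have ov := off_bell_ge m0 (norm_rc z.1).
have Yle : (1 + Y) ^+ (2 * N) <= D *
  (expR (2 * (2 * N)%:R * m) * (1 + E * Q) ^+ (2 * N)).
  have -> : expR (2 * (2 * N)%:R * m) = expR (2 * m) ^+ (2 * N).
    by rewrite -expRM_natl; congr expR; ring.
  have NC : 0 <= N%:R * C1 by rewrite mulr_ge0.
  have e1 : 1 <= expR (2 * m) by rewrite -expR0 ler_expR mulr_ge0.
  have eE : expR (2 * m) * E = 1 by rewrite -expRD subrr expR0.
  have Z0 : 0 <= expR (2 * m) * (1 + E * Q) by rewrite mulr_ge0 ?expR_ge0 //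
    addr_ge0.
  have X0 : 0 <= (1 + N%:R * C1) * (expR (2 * m) * (1 + E * Q)).
    by rewrite mulr_ge0 // addr_ge0.
  rewrite /D -!exprMn; apply: lerXn2r; rewrite ?nnegrE //;
    first by rewrite addr_ge0.
  apply: (@le_trans _ _ ((1 + N%:R * C1) * (1 + Q))).
    by rewrite /Y; nra.
  by rewrite ler_wpM2l ?addr_ge0 // mulrDr mulr1 [_ * (E * Q)]mulrA eE mul1r lerD2r.
have vle : (1 + m) ^+ (2 * N) <= Cv * expR m by rewrite -[in expR m](mul1r m);
  exact: hv.
have sle := hs _ EQ0; rewrite mul1r in sle.
have off0 : 0 <= off_bell z.1 * off_bell z.2 by rewrite mulr_ge0 // ltW //
  off_bell_gt0.
have kk : expR (- (L * m)) * expR (K * m) * (expR m * expR (2 * (2 * N)%:R * m)) =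
  1.
  by rewrite -!expRD -[RHS]expR0; congr expR; rewrite /L; ring.
apply: (@le_trans _ _ ((Cb * expR (- (L * m)) * expR (- (E * Q)) * expR (K * m)) *
    ((off_bell z.1 * (1 + m) ^+ (2 * N)) * (off_bell z.2 * (1 + Y) ^+ (2 * N))))).
  apply: (@le_trans _ _ (Cb * expR (- (L * m)) * expR (- (E * Q)) * expR (K * m))).
    by rewrite ler_wpM2r ?expR_ge0.
  rewrite ler_peMr ?mulr_ge0 ?expR_ge0 //.
  by rewrite -[leLHS]mulr1; apply: ler_pM.
apply: (@le_trans _ _ ((Cb * expR (- (L * m)) * expR (- (E * Q)) * expR (K * m)) *
    ((off_bell z.1 * (Cv * expR m)) *
      (off_bell z.2 * (D * (expR (2 * (2 * N)%:R * m) * (1 + E * Q) ^+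
        (2 * N))))))).
  rewrite ler_wpM2l ?mulr_ge0 ?expR_ge0 //.
  apply: ler_pM; rewrite ?mulr_ge0 ?exprn_ge0 ?addr_ge0 ?(ltW (off_bell_gt0 _)) //.
    by rewrite ler_wpM2l // ltW // off_bell_gt0.
  by rewrite ler_wpM2l // ltW // off_bell_gt0.
rewrite [leLHS](_ : _ = (expR (- (L * m)) * expR (K * m) *
  (expR m * expR (2 * (2 * N)%:R * m))) *
  (Cb * Cv * (D * ((1 + E * Q) ^+ (2 * N) * expR (- (E * Q))))) *
    (off_bell z.1 * off_bell z.2)).
  by rewrite kk mul1r ler_wpM2r // ler_wpM2l ?mulr_ge0 // ler_wpM2l.
move: (expR (- (L * m))) (expR (K * m)) (expR m) (expR (2 * (2 * N)%:R * m))
  (expR (- (E * Q))) ((1 + E * Q) ^+ (2 * N)) (off_bell _) (off_bell _) => *; clear;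
    ring.
Qed.

End domination.

(** * Uniform domination of the zoomed integrand *)

Section full_domination.
Variables (R : realType) (V : finType) (e : rel V) (beta : V -> V -> R).
Hypotheses (es : symmetric e) (ei : irreflexive e).
Hypotheses (econn : connected_graph e) (b0 : forall i j, e i j -> 0 < beta i j).
Variables (x : V) (q : V -> R).
Hypotheses (q0 : forall i, 0 <= q i) (qx : 0 < q x).
Local Notation RV := (RV R V).
Local Notation tree := (spanning_tree e).
Local Notation k := (enum_rank x).
Local Notation N := #|V|.
Local Notation rc := (rel_coord x).
Local Notation ht := (height x q).
Local Notation exptype := (exptype e x).

(** Only the pinning at x is kept: the term with the height controls large
    fields, the one with its inverse controls the contribution of trees with
    several edges at rho. *)
Lemma pinning_le r z : 0 < r -> r <= 1 -> pinning x q r z <=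
  expR (\sum_i q i) * (expR (- (q x / 2 * (ht z * (1 + tnth z.2 k ^+ 2)))) *
    expR (- (q x / 2 * (r ^+ 2 / ht z)))).
Proof.
move=> r0 r1; have h0 : 0 < ht z by exact: height_gt0.
rewrite /pinning -expR_sum -!expRD ler_expR !(bigD1 x (P := xpredT)) //= !rel_coordx
  expR0 !mulr1 mulr0 addr0.
have : \sum_(i | i != x) - (q i * (ht z * expR (rc z.1 i) *
     (1 + (tnth z.2 k + r / ht z * rc z.2 i) ^+ 2) / 2 +
     r ^+ 2 / (ht z * expR (rc z.1 i)) / 2 - r)) <= \sum_(i | i != x) q i.
  apply: ler_sum => i _; rewrite -mulrN -[leRHS]mulr1 ler_wpM2l // opprB lerBlDr.
  have : 0 <= ht z * expR (rc z.1 i) * (1 + (tnth z.2 k + r / ht z * rc z.2 i) ^+ 2)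
    / 2.
    by rewrite divr_ge0 // mulr_ge0 ?(ltW (oneD_gt0 _)) // mulr_ge0 ?expR_ge0 //
      ltW.
  have : 0 <= r ^+ 2 / (ht z * expR (rc z.1 i)) / 2.
    by rewrite divr_ge0 // divr_ge0 ?sqr_ge0 // mulr_ge0 ?expR_ge0 // ltW.
  lra.
have : q x * r <= q x by rewrite ler_piMr // ltW.
set X := \sum_(i | _) _; set Y := \sum_(i | _) _.
move: (r ^+ 2 / ht z) => w; nra.
Qed.

(** In terms of w = e^(v_x) / mass the left side is w e^(- q_x w / 2) / (1 +
    a^2), which decays at least like e^(- |v_x|) up to the factor 1 + mass. *)
Lemma height_dominated : exists2 C : R, 0 <= C & forall z,
  ht z * expR (- (q x / 2 * (ht z * (1 + tnth z.2 k ^+ 2)))) <=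
  C * (1 + mass x q z.1) * (bell (tnth z.1 k) * bell (tnth z.2 k)).
Proof.
have c0 : 0 < q x / 2 by rewrite divr_gt0.
have [C C0 hC] := oneDX_expRN_bounded 2 c0.
exists (4 * (C + 1 / q x)) => [|z].
  by rewrite mulr_ge0 // addr_ge0 // divr_ge0 // ltW.
set m := mass x q z.1; set u := tnth z.1 k; set a := tnth z.2 k.
have m0 : 0 < m by exact: mass_gt0.
have a0 := oneD_gt0 a; have u0 := oneD_gt0 u.
pose rho := expR u / m.
have rho0 : 0 < rho by rewrite divr_gt0 // expR_gt0.
have htE : ht z = rho * bell a.
  by rewrite /height /rho /bell -/m -/u -/a invfM mulrCA mulrC -mulrA mulrC.
have -> : ht z * (1 + a ^+ 2) = rho.
  by rewrite htE /bell mulfVK // gt_eqF.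
rewrite htE mulrA [leLHS]mulrAC ler_pM2r ?bell_gt0 //.
rewrite /bell ler_pdivlMr //.
set E := expR (- (q x / 2 * rho)).
have E1 : E <= 1 by rewrite -expR0 ler_expR oppr_le0 mulr_ge0 // ltW.
have E0 : 0 <= E by exact: expR_ge0.
have hr := hC _ (ltW rho0); rewrite -/E in hr.
have bu := oneDsqr_le_expR u.
have r1 : rho * expR u = m * rho ^+ 2.
  by rewrite /rho; field; rewrite gt_eqF.
have r2 : rho * expR (- u) = m^-1.
  by rewrite /rho mulrAC -expRD subrr expR0 mul1r.
have mi : m^-1 <= 1 / q x.
  by rewrite div1r lef_pV2 ?posrE // mass_ge.
apply: (@le_trans _ _ (rho * E * (4 * (expR u + expR (- u))))).
  by rewrite ler_wpM2l // mulr_ge0 // ltW.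
have -> : rho * E * (4 * (expR u + expR (- u))) =
  4 * (m * (rho ^+ 2 * E) + m^-1 * E).
  by rewrite -r2; transitivity (4 * (rho * expR u * E + rho * expR (- u) * E));
    [ring | rewrite r1; ring].
rewrite -mulrA ler_pM2l //.
have e1 : rho ^+ 2 * E <= C.
  apply: le_trans hr; rewrite ler_wpM2r //; nra.
have e2 : m^-1 * E <= 1 / q x.
  by rewrite -[leRHS]mulr1 ler_pM // invr_ge0 ltW.
have e3 : m * (rho ^+ 2 * E) <= m * C by rewrite ler_pM2l.
have qx' : 0 <= 1 / q x by rewrite divr_ge0 // ltW.
nra.
Qed.

Lemma exptype_tree_weight (T : tree) : exptype (tree_weight beta x q T).
Proof.
apply: exptypeM.
  apply: exptype_prod => v _; apply: exptypeM; first exact: exptype_cst.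
  exact: exptype_expR.
apply: exptype_prod => p pT; apply: exptypeM.
  apply: exptype_cst; apply/ltW/b0.
  by move: pT => /andP[_ /(adj_ext es)].
rewrite (_ : (fun v => _) = fun v => expR (rc v p.1) * expR (rc v p.2)).
  by apply: exptypeM; exact: exptype_expR.
by apply/funext => v; rewrite expRD.
Qed.

(** The bound on g is the one satisfied by r times the observable, both for
    the Green's function and for the tree observable. *)
Lemma integrand_dominated (T : tree) (y : V) : exists2 C : R, 0 <= C &
  forall r z g, 0 < r -> r <= 1 -> 0 <= g <= ht z * expR (rc z.1 y) / q x ->
  0 <= base e beta x z * pinning x q r z * tree_weight beta x q T z.1 *
    (r ^+ 2 / ht z) ^+ (#|rho_nbr (val T)|.-1) * g <= C *
      (bell_prod z.1 * bell_prod z.2).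
Proof.
pose P v := \prod_(j : V) (expR (- rc v j) / (2 * pi) : R).
have [C1 [K1 [C10 K10 h1]]] : exptype (fun v => P v *
    (tree_weight beta x q T v * (expR (rc v y) / q x * (1 + mass x q v)))).
  apply: exptypeM.
    apply: exptype_prod => j _; apply: exptypeM; first exact: exptype_expRN.
    by apply: exptype_cst; rewrite invr_ge0 mulr_ge0 // pi_ge0.
  apply: exptypeM; first exact: exptype_tree_weight.
  apply: exptypeM.
    apply: exptypeM; first exact: exptype_expR.
    by apply: exptype_cst; rewrite invr_ge0 ltW.
  apply: exptypeD; first exact: exptype_cst.
  apply: exptype_sum => i _; apply: exptypeM; first exact: exptype_cst.
  exact: exptype_expR.
have [C2 C20 h2] := bond_weight_dominated es ei econn b0 x K10.
have [C3 C30 h3] := height_dominated.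
have [C4 C40 h4] := oneDX_expRN_bounded N (divr_gt0 qx (ltr0n R 2)).
exists (C1 * C2 * C3 * C4 * expR (\sum_i q i)) => [|r z g r0 r1 /andP[g0 gle]].
  by rewrite !mulr_ge0 // expR_ge0.
have hz0 : 0 < ht z by exact: height_gt0.
have P0 : 0 <= P z.1.
  by apply: prodr_ge0 => j _; rewrite divr_ge0 ?expR_ge0 // mulr_ge0 // pi_ge0.
have [Ct [Kt [_ _ /(_ z.1)/andP[tw0 _]]]] := exptype_tree_weight T.
have bw0 : 0 <= bond_weight e beta x z by apply: prodr_ge0 => p _; exact: expR_ge0.
have pin0 : 0 <= pinning x q r z by apply: prodr_ge0 => p _; exact: expR_ge0.
have baseE : base e beta x z = P z.1 * bond_weight e beta x z by [].
pose w := r ^+ 2 / ht z.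
have w0 : 0 <= w by rewrite divr_ge0 ?sqr_ge0 // ltW.
rewrite -/w baseE.
set M := #|_|.-1.
have wM : w ^+ M <= (1 + w) ^+ N.
  apply: (@le_trans _ _ ((1 + w) ^+ M)).
    by apply: lerXn2r; rewrite ?nnegrE ?addr_ge0 // lerDr.
  rewrite ler_weXn2l //; first by rewrite lerDl.
  by apply: leq_trans (leq_pred _) _; exact: max_card.
set F := expR (- (q x / 2 * (ht z * (1 + tnth z.2 k ^+ 2)))).
set G := expR (- (q x / 2 * w)).
have pl := pinning_le z r0 r1; rewrite -/w -/F -/G in pl.
have F0 : 0 <= F by exact: expR_ge0. have G0 : 0 <= G by exact: expR_ge0.
have h4z := h4 _ w0; rewrite -/G in h4z.
have h3z := h3 z; rewrite -/F in h3z.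
have h2z := h2 z. have /andP[h10 h1z] := h1 z.1.
set S := expR (\sum_i q i) in pl *; have S0 : 0 <= S by exact: expR_ge0.
set tw := tree_weight beta x q T z.1 in tw0 h1z *;
  set bw := bond_weight e beta x z in bw0 h2z *.
set m := 1 + mass x q z.1 in h1z h3z *.
have m0 : 0 <= m by rewrite addr_ge0 // ltW // mass_gt0.
set Y := expR (rc z.1 y) in gle h1z *; have Y0 : 0 <= Y by exact: expR_ge0.
set E := expR (K1 * spread e x z.1) in h1z h2z; have E0 : 0 <= E by exact: expR_ge0.
set Bk := bell (tnth z.1 k) * bell (tnth z.2 k) in h3z *.
have Bk0 : 0 <= Bk by rewrite mulr_ge0 // ltW // bell_gt0.
set Bo := off_bell x z.1 * off_bell x z.2 in h2z *.
have Bo0 : 0 <= Bo by rewrite mulr_ge0 // ltW // off_bell_gt0.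
have iq0 : 0 <= (q x)^-1 by rewrite invr_ge0 ltW.
have -> : bell_prod z.1 * bell_prod z.2 = Bk * Bo.
  by rewrite !(bell_prodE x) /Bk /Bo mulrACA.
move: (P z.1) P0 h1z h10 => Pz P0 h1z _; clear h1 h2 h3 h4 baseE.
have hz0' := ltW hz0; clearbody tw bw m Y E S F G Bk Bo w M.
rewrite !mulr_ge0 ?exprn_ge0 //=.
apply: (@le_trans _ _ (Pz * bw * (S * (F * G)) * tw * (1 + w) ^+ N *
  (ht z * Y / q x))).
  apply: ler_pM => //; rewrite ?mulr_ge0 ?exprn_ge0 //.
  apply: ler_pM => //; rewrite ?mulr_ge0 ?exprn_ge0 //.
  by apply: ler_wpM2r => //; apply: ler_wpM2l; rewrite ?mulr_ge0.
have -> : Pz * bw * (S * (F * G)) * tw * (1 + w) ^+ N * (ht z * Y / q x) =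
  S * ((1 + w) ^+ N * G) * (ht z * F) * bw * (Pz * tw * (Y / q x)).
  by move: ((1 + w) ^+ N) => W; ring.
have d1 : S * ((1 + w) ^+ N * G) <= S * C4 by rewrite ler_wpM2l.
have A0 : 0 <= S * ((1 + w) ^+ N * G) by rewrite !mulr_ge0 // exprn_ge0 // addr_ge0.
apply: (@le_trans _ _ (S * C4 * (C3 * m * Bk) * bw * (Pz * tw * (Y / q x)))).
  do 2![apply: ler_wpM2r; rewrite ?mulr_ge0 //].
  by apply: ler_pM => //; exact: mulr_ge0.
have -> : S * C4 * (C3 * m * Bk) * bw * (Pz * tw * (Y / q x)) =
  S * C4 * C3 * Bk * bw * (Pz * (tw * (Y / q x * m))) by ring.
apply: (@le_trans _ _ (S * C4 * C3 * Bk * bw * (C1 * E))).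
  by apply: ler_wpM2l; rewrite ?mulr_ge0.
have -> : S * C4 * C3 * Bk * bw * (C1 * E) =
  S * C4 * C3 * Bk * C1 * (bw * E) by ring.
have -> : C1 * C2 * C3 * C4 * S * (Bk * Bo) =
  S * C4 * C3 * Bk * C1 * (C2 * Bo) by ring.
by apply: ler_wpM2l; rewrite ?mulr_ge0.
Qed.

End full_domination.

(** * The limit of weak pinning *)

Section scaling.
Variables (R : realType) (V : finType) (e : rel V) (beta : V -> V -> R).
Hypotheses (es : symmetric e) (ei : irreflexive e).
Hypotheses (econn : connected_graph e) (b0 : forall i j, e i j -> 0 < beta i j).
Variables (x : V) (q : V -> R).
Hypotheses (q0 : forall i, 0 <= q i) (qx : 0 < q x).
Local Notation RV := (RV R V).
Local Notation tree := (spanning_tree e).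
Local Notation k := (enum_rank x).
Local Notation N := #|V|.
Local Notation rc := (rel_coord x).
Local Notation ht := (height x q).
Local Notation zoom := (zoom x q).
Local Notation lam2 := (@lebesgue_tuple R N \x @lebesgue_tuple R N)%E.

Lemma measurable_rc i : measurable_fun setT (fun v : RV => rc v i).
Proof.
rewrite /rel_coord; case: (i == x); first exact: measurable_cst.
exact: measurable_tnth.
Qed.

Lemma measurable_mass : measurable_fun setT (mass x q : RV -> R).
Proof.
apply: measurable_sum => i; apply: measurable_funM => //.
by apply: measurableT_comp => //; exact: measurable_rc.
Qed.

Lemma measurable_zoom_shift r : measurable_fun setT
  (zoom_shift x q r : RV * RV -> R).
Proof.
apply: measurable_funB; first apply: measurable_funB => //.
  apply: (measurableT_comp (@measurable_ln R)).
  apply: measurable_funD => //; apply: measurable_funX.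
  exact: measurable_tnth_comp.
apply: (measurableT_comp (@measurable_ln R)).
exact: (measurableT_comp measurable_mass (@measurable_fst _ _ _ _)).
Qed.

Lemma measurable_zoom r : measurable_fun setT (zoom r).
Proof.
apply: measurable_shear_pair; last exact: measurable_zoom_shift.
by apply: measurableT_comp => //.
Qed.

Lemma zoom_shift_indep r (v w s : RV) : (forall j, j != k -> tnth v j = tnth w j) ->
  zoom_shift x q r (v, s) = zoom_shift x q r (w, s).
Proof.
move=> h; rewrite /zoom_shift /=; congr (_ - ln _); rewrite /mass;
  apply: eq_bigr => i _.
congr (_ * expR _); rewrite /rel_coord; case: eqP => // /eqP ix; apply: h.
by rewrite (inj_eq enum_rank_inj).
Qed.

(** The constant term is e^(v_x) / 2 for every value of the differences: this
    is the purpose of the shift in [zoom_shift]. *)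
Lemma pinning_quadratic z : exists c1 c2 : R, forall r,
  pinning x q r z = expR (- (expR (tnth z.1 k) / 2 + r * c1 + r ^+ 2 * c2)).
Proof.
have h0 : 0 < ht z by exact: height_gt0.
set a := tnth z.2 k.
exists (\sum_i q i * (expR (rc z.1 i) * a * rc z.2 i - 1)).
exists (\sum_i q i * (expR (rc z.1 i) * rc z.2 i ^+ 2 / ht z / 2 +
  (ht z * expR (rc z.1 i))^-1 / 2)) => r.
have -> : expR (tnth z.1 k) = \sum_i q i * expR (rc z.1 i) * (ht z * (1 + a ^+ 2)).
  rewrite -mulr_suml -/(mass x q z.1) /height -/a.
  by field; rewrite !gt_eqF ?oneD_gt0 ?mass_gt0.
rewrite /pinning -expR_sum sumrN mulr_suml !mulr_sumr -!big_split /=;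
  congr (expR (- _)).
apply: eq_bigr => i _; have e0 := expR_gt0 (rc z.1 i).
by rewrite -/a; field; rewrite !gt_eqF.
Qed.

Lemma cvg_pinning z :
  pinning x q r z @[r --> 0^'+] --> expR (- (expR (tnth z.1 k) / 2)).
Proof.
have [c1 [c2 E]] := pinning_quadratic z.
rewrite (_ : pinning x q ^~ z = fun r =>
  expR (- (expR (tnth z.1 k) / 2 + r * c1 + r ^+ 2 * c2))); last exact/funext.
have -> : expR (- (expR (tnth z.1 k) / 2)) =
   (fun r => expR (- (expR (tnth z.1 k) / 2 + r * c1 + r ^+ 2 * c2))) 0.
  by rewrite mul0r expr0n mul0r !addr0.
apply: cvg_at_right_filter.
apply: continuous_comp; last exact: continuous_expR.
apply: continuousN; apply: continuousD.
  apply: continuousD; first exact: cst_continuous.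
  by apply: continuousM; [exact: cvg_id|exact: cst_continuous].
apply: continuousM; last exact: cst_continuous.
exact: exprn_continuous.
Qed.

Lemma cvg_rho_factor z (T : tree) :
  (r ^+ 2 / ht z) ^+ #|rho_nbr (val T)|.-1 @[r --> 0^'+] -->
  ((#|rho_nbr (val T)| == 1%N)%:R : R).
Proof.
set m := #|_|; have m1 : (0 < m)%N by exact: rho_nbr_neq0.
have -> : (m == 1%N)%:R = (fun r => (r ^+ 2 / ht z) ^+ m.-1) 0 :> R.
  by rewrite expr0n mul0r expr0n; case: m m1 => [|[|]].
apply: cvg_at_right_filter.
have c1 : {for 0, continuous (fun r : R => r ^+ 2 / ht z)}.
  by apply: continuousM; [exact: exprn_continuous|exact: cst_continuous].
exact: (continuous_comp c1 (@exprn_continuous R m.-1 _)).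
Qed.

Variables (y : V) (f : R -> config R e -> R) (psi : RV * RV -> tree -> R).
Hypothesis mf : forall r, 0 < r -> measurable_fun setT (f r).
Hypothesis fb : forall r w, 0 < r ->
  0 <= f r w <= expR (coord w.1.1 (Some y)) / q x.
Hypothesis fl : forall z T, r * f r (zoom r z, T) @[r --> 0^'+] --> ht z * psi z T.

(** Jacobian times observable times density, after the change of variables. *)
Definition zoomed (r : R) (z : RV * RV) (T : tree) : R :=
  expR (- tnth (zoom r z).1 k) ^+ N.-1 *
    (f r (zoom r z, T) * density beta (fun i => q i * r) (zoom r z, T)).

Definition limit_integrand (z : RV * RV) (T : tree) : R :=
  base e beta x z * expR (- (expR (tnth z.1 k) / 2)) * tree_weight beta x q T z.1 *
  (#|rho_nbr (val T)| == 1%N)%:R * (ht z * psi z T).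

Lemma expect_zoomed r : 0 < r ->
  expect beta (fun i => q i * r) (f r) =
  (\int[lam2]_z (\sum_T zoomed r z T)%:E)%E.
Proof.
move=> r0.
have eps0 i : 0 <= q i * r by rewrite mulr_ge0 // ltW.
have f0 w : 0 <= f r w by have /andP[] := fb w r0.
have mg : measurable_fun setT (fun w => f r w * density beta (fun i => q i * r) w).
  by apply: measurable_funM; [exact: mf|exact: measurable_density].
have msum : measurable_fun setT
  (fun z => (\sum_T f r (z, T) * density beta (fun i => q i * r) (z, T))%:E).
  apply/measurable_EFinP; apply: measurable_sum => T.
  exact: (measurable_tree_section T mg).
rewrite (expectE es b0 eps0 (mf r0) f0).
have mexp : measurable_fun setT (fun u : measurableTypeR R => expR (- u) : R).
  by apply: measurableT_comp.
have sum0 z : (0 <= (\sum_T f r (z, T) * density beta (fun i => q i * r)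
  (z, T))%:E)%E.
  by rewrite lee_fin; apply: sumr_ge0 => T _; rewrite mulr_ge0 // density_ge0.
have E := integral_shear_pair mexp (fun u => expR_gt0 (- u))
  (measurable_zoom_shift r) (@zoom_shift_indep r) msum sum0.
apply: (eq_trans E); apply: eq_integral => z _.
by rewrite -EFinM mulr_sumr.
Qed.

Lemma measurable_zoomed r : 0 < r ->
  measurable_fun setT (fun z => \sum_T zoomed r z T).
Proof.
move=> r0; apply: measurable_sum => T; apply: measurable_funM.
  apply: measurable_funX; apply: measurableT_comp => //.
  apply: measurable_funN; apply: measurable_tnth_comp.
  by apply: measurableT_comp => //; exact: measurable_zoom.
have mg : measurable_fun setT (fun w => f r w * density beta (fun i => q i * r) w).
  by apply: measurable_funM; [exact: mf|exact: measurable_density].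
exact: (measurableT_comp (measurable_tree_section T mg) (measurable_zoom r)).
Qed.

Lemma zoomedE r z T : 0 < r -> zoomed r z T =
  base e beta x z * pinning x q r z * tree_weight beta x q T z.1 *
  (r ^+ 2 / ht z) ^+ (#|rho_nbr (val T)|.-1) * (r * f r (zoom r z, T)).
Proof. by move=> r0; rewrite /zoomed zoom_density. Qed.

Lemma cvg_zoomed z : \sum_T zoomed r z T @[r --> 0^'+] -->
  \sum_T limit_integrand z T.
Proof.
apply: cvg_big => [|T _]; first exact: add_continuous.
apply: (@cvg_trans _ ((fun r =>
  base e beta x z * pinning x q r z * tree_weight beta x q T z.1 *
  (r ^+ 2 / ht z) ^+ (#|rho_nbr (val T)|.-1) * (r * f r (zoom r z, T))) @ 0^'+)).
  by apply: near_eq_cvg; near=> r; rewrite zoomedE.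
apply: cvgM; last exact: fl.
apply: cvgM; last exact: cvg_rho_factor.
apply: cvgM; last exact: cvg_cst.
by apply: cvgM; [exact: cvg_cst|exact: cvg_pinning].
Unshelve. all: by end_near. Qed.

Lemma zoomed_dominated : exists2 C : R, 0 <= C & forall r z, 0 < r -> r <= 1 ->
  0 <= \sum_T zoomed r z T <= C * (bell_prod z.1 * bell_prod z.2).
Proof.
have h T : exists C : R, 0 <= C /\ forall r z, 0 < r -> r <= 1 ->
    0 <= zoomed r z T <= C * (bell_prod z.1 * bell_prod z.2).
  have [C C0 hC] := integrand_dominated es ei econn b0 q0 qx T y.
  exists C; split => // r z r0 r1; rewrite zoomedE //; apply: hC => //.
  have /andP[f0 fle] := fb (zoom r z, T) r0.
  rewrite mulr_ge0 ?(ltW r0) //=.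
  apply: (le_trans (ler_wpM2l (ltW r0) fle)); rewrite /= -/coord expR_zoom1 //.
  by rewrite le_eqVlt; apply/orP; left; apply/eqP; field; rewrite !gt_eqF.
have [C hC] := choice h.
exists (\sum_T C T) => [|r z r0 r1]; first by apply: sumr_ge0 => T _; case: (hC T).
apply/andP; split; first by apply: sumr_ge0 => T _;
  case: (hC T) => _ /(_ r z r0 r1)/andP[].
by rewrite mulr_suml; apply: ler_sum => T _;
  case: (hC T) => _ /(_ r z r0 r1)/andP[].
Qed.

(** Domination holds only for r <= 1, so the sequence is first truncated at 1. *)
Lemma zoomed_seq_cvg (u : R^nat) : (forall n, 0 < u n) -> u @ \oo --> 0 ->
  lam2.-integrable setT (fun z => (\sum_T limit_integrand z T)%:E) /\
  ((\int[lam2]_z (\sum_T zoomed (u n) z T)%:E)%E @[n --> \oo] -->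
   (\int[lam2]_z (\sum_T limit_integrand z T)%:E)%E).
Proof.
move=> u0 ucvg; pose w n := Num.min (u n) 1.
have w0 n : 0 < w n by rewrite lt_min u0 ltr01.
have w1 n : w n <= 1 by rewrite ge_min lexx orbT.
have uw : \forall n \near \oo, u n = w n.
  near=> n; rewrite /w min_l //; near: n.
  by apply: (cvgr_le 0) => //; exact: ltr01.
have wcvg : w @ \oo --> 0.
  apply: cvg_trans ucvg; apply: near_eq_cvg; near=> n.
  by near: n.
have [C C0 hC] := zoomed_dominated.
have pt z : \sum_T zoomed (w n) z T @[n --> \oo] --> \sum_T limit_integrand z T.
  have /cvg_at_rightP := @cvg_zoomed z; apply; split => //.
have ml : measurable_fun setT (fun z => \sum_T limit_integrand z T).
  by apply: (measurable_fun_cvg (fun n => measurable_zoomed (w0 n))) => z _;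
    exact: pt.
pose g (z : RV * RV) := (C * (bell_prod z.1 * bell_prod z.2) : R)%:E.
have mb : measurable_fun setT (fun z : RV * RV => bell_prod z.1 * bell_prod z.2).
  by apply: measurable_funM; apply: measurableT_comp => //;
    exact: measurable_bell_prod.
have ig : lam2.-integrable setT g.
  apply/integrableP; split.
    by apply/measurable_EFinP; apply: measurable_funM.
  have -> : (\int[lam2]_z `|g z| =
    \int[lam2]_z (C%:E * (bell_prod z.1 * bell_prod z.2)%:E))%E.
    apply: eq_integral => z _; rewrite /g /= ger0_norm //.
    by rewrite mulr_ge0 // mulr_ge0 // ltW // bell_prod_gt0.
  have b00 (z : RV * RV) : setT z -> (0 <= (bell_prod z.1 * bell_prod z.2)%:E)%E.
    by move=> _; rewrite lee_fin mulr_ge0 // ltW // bell_prod_gt0.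
  have mb' : measurable_fun setT
    (fun z : RV * RV => (bell_prod z.1 * bell_prod z.2)%:E).
    exact/measurable_EFinP.
  have E := ge0_integralZl_EFin lam2 measurableT b00 mb' C0.
  rewrite E lte_mul_pinfty ?lee_fin //.
  exact: integral_bell_prod2_lty.
have mz n : measurable_fun setT (fun z => (\sum_T zoomed (w n) z T)%:E).
  by apply/measurable_EFinP; exact: measurable_zoomed.
have ml' : measurable_fun setT (fun z => (\sum_T limit_integrand z T)%:E) by
  exact/measurable_EFinP.
have pt' z : (\sum_T zoomed (w n) z T)%:E @[n --> \oo] -->
  (\sum_T limit_integrand z T)%:E.
  by apply: cvg_EFin; [exact: nearW|exact: pt].
have dom (n : nat) z : (`|(\sum_T zoomed (w n) z T)%:E| <= g z)%E.
  have /andP[s0 sle] := hC (w n) z (w0 n) (w1 n).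
  by rewrite /= ger0_norm // lee_fin.
have [i1 _ i3] := dominated_convergence measurableT mz ml'
  (aeW lam2 (fun z _ => pt' z)) ig (aeW lam2 (fun z n _ => dom n z)).
split; first exact: i1.
apply: cvg_trans i3; apply: near_eq_cvg; near=> n.
have -> : u n = w n by near: n.
reflexivity.
Unshelve. all: by end_near. Qed.

(** Expectations under weak pinning converge for any family of observables f
    that is bounded by e^(t_y) / q_x and such that r f has a limit in the
    zoomed coordinates. *)
Theorem scaling_limit :
  (lam2.-integrable setT (fun z => (\sum_T limit_integrand z T)%:E)) /\
  (expect beta (fun i => q i * r) (f r) @[r --> 0^'+] -->
   (\int[lam2]_z (\sum_T limit_integrand z T)%:E)%E).
Proof.
have [u0 ucvg] : (forall n, 0 < n.+1%:R^-1 :> R) /\ (n.+1%:R^-1 : R) @[n --> \oo]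
  --> 0.
  by split => [n|]; [rewrite invr_gt0|exact: cvg_harmonic].
have [ig _] := zoomed_seq_cvg u0 ucvg; split; first exact: ig.
have fin := integrable_fin_num measurableT ig.
rewrite -(fineK fin); apply/cvge_at_rightP => u [{}u0 {}ucvg]; rewrite fineK //.
have [_ h] := zoomed_seq_cvg u0 ucvg.
apply: cvg_trans h; apply: near_eq_cvg; near=> n.
by rewrite expect_zoomed.
Unshelve. all: by end_near. Qed.

End scaling.

(** * The Green's function as the inverse of a grounded network *)

Section measurable_inverse.
Context d (T : measurableType d) (R : realType).

Lemma measurable_determinant n (M : T -> 'M[R]_n) :
  (forall i j, measurable_fun setT (fun w => M w i j)) ->
  measurable_fun setT (fun w => \det (M w)).
Proof.
move=> mM; apply: measurable_sum => s; apply: measurable_funM => //.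
by apply: measurable_prod => i _; exact: mM.
Qed.

(** The inverse is written through a real power, defined for nonnegative
    arguments, of the square. *)
Lemma measurable_funV (f : T -> R) : measurable_fun setT f ->
  measurable_fun setT (fun w => (f w)^-1).
Proof.
move=> mf; rewrite (_ : (fun _ => _) = fun w => f w * ((f w ^+ 2) `^ (-1))).
  apply: measurable_funM => //; apply: (measurableT_comp (@measurable_powR R (-1))).
  exact: measurable_funX.
apply/funext => w; rewrite powR_inv1 ?sqr_ge0 //.
have [->|f0] := eqVneq (f w) 0; first by rewrite mul0r invr0.
by rewrite expr2 invfM mulrA mulfV // mul1r.
Qed.

(** Cramer's rule expresses the entries of the inverse through determinants. *)
Lemma measurable_invmx n (M : T -> 'M[R]_n) i j :
  (forall i j, measurable_fun setT (fun w => M w i j)) ->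
  (forall w, M w \in unitmx) ->
  measurable_fun setT (fun w => invmx (M w) i j).
Proof.
move=> mM uM; rewrite (_ : (fun _ => _) = fun w =>
  (\det (M w))^-1 * cofactor (M w) j i).
  apply: measurable_funM.
    exact: measurable_funV (measurable_determinant mM).
  apply: measurable_funM => //; apply: measurable_determinant => k l.
  rewrite (_ : (fun _ => _) = fun w => M w (lift j k) (lift i l)); first exact: mM.
  by apply/funext => w; rewrite !mxE.
by apply/funext => w; rewrite /invmx uM !mxE.
Qed.

End measurable_inverse.

Section green_function.
Variables (R : realType) (V : finType) (e : rel V) (beta : V -> V -> R).
Hypotheses (es : symmetric e) (ei : irreflexive e).
Hypotheses (econn : connected_graph e) (b0 : forall i j, e i j -> 0 < beta i j).
Hypothesis bs : forall i j, e i j -> beta i j = beta j i.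
Local Notation RV := (RV R V).
Local Notation tree := (spanning_tree e).
Local Notation N := #|V|.

Lemma sum_enum_val (F : V -> R) : \sum_a F a = \sum_(i < N) F (enum_val i).
Proof. by rewrite -(big_enum_val (A := V)); apply: eq_bigl => a; rewrite inE. Qed.

Definition conductance (tau : V -> R) (i j : 'I_N) : R :=
  if e (enum_val i) (enum_val j)
  then beta (enum_val i) (enum_val j) * expR (tau (enum_val i) + tau (enum_val j))
  else 0.

Lemma conductance_sym tau i j : conductance tau i j = conductance tau j i.
Proof.
rewrite /conductance es; case: ifP => // eji.
by rewrite (bs eji) [tau (enum_val j) + _]addrC.
Qed.

Lemma conductance_ge0 tau i j : 0 <= conductance tau i j.
Proof.
by rewrite /conductance; case: ifP => // /b0 h; rewrite mulr_ge0 ?expR_ge0 // ltW.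
Qed.

Lemma conductance_conn tau i j : connect (fun i j => 0 < conductance tau i j) i j.
Proof.
rewrite -(enum_valK i) -(enum_valK j).
have /connectP[p pe ->] := forallP (forallP econn (enum_val i)) (enum_val j).
apply/connectP; exists (map enum_rank p); last by rewrite last_map.
rewrite path_map; apply: sub_path pe => a b /= eab.
by rewrite /conductance !enum_rankK eab mulr_gt0 ?expR_gt0 // b0.
Qed.

Lemma laplacianE (eps : V -> R) (t : RV) :
  laplacian e beta t + eps_hat eps t =
  network_mx (conductance (fun i => coord t (Some i)))
    (fun i => eps (enum_val i) * expR (coord t (Some (enum_val i)))).
Proof.
apply/matrixP => i j; rewrite !mxE /= (inj_eq enum_val_inj).
case: eqP => [->|ij]; last by rewrite /conductance; case: ifP;
  rewrite ?mulr0n ?addr0 ?oppr0.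
rewrite mulr1n; congr (_ + _).
rewrite [RHS](_ : _ = \sum_l conductance (fun i => coord t (Some i)) l j);
  last first.
  by rewrite [RHS](bigD1 j) //= {2}/conductance ei add0r.
rewrite big_mkcond; apply: (eq_trans (sum_enum_val (fun k => if e k (enum_val j)
  then beta k (enum_val j) * expR (coord t (Some k) + coord t (Some (enum_val j)))
    else 0))).
by apply: eq_bigr => l _; rewrite /conductance.
Qed.

Variables (x : V) (q : V -> R).
Hypotheses (q0 : forall i, 0 <= q i) (qx : 0 < q x).
Variable y : V.
Local Notation k := (enum_rank x).
Local Notation rc := (rel_coord x).
Local Notation ht := (height x q).
Local Notation zoom := (zoom x q).
Local Notation G r := (@green R V e beta (fun i => q i * r) x y).

Lemma pin_ge0 r (t : RV) : 0 < r -> forall i : 'I_N,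
  0 <= q (enum_val i) * r * expR (coord t (Some (enum_val i))).
Proof. by move=> r0 i; rewrite mulr_ge0 ?expR_ge0 // mulr_ge0 // ltW. Qed.

Lemma pin_gt0 r (t : RV) : 0 < r ->
  0 < q (enum_val k) * r * expR (coord t (Some (enum_val k))).
Proof. by move=> r0; rewrite enum_rankK mulr_gt0 ?expR_gt0 // mulr_gt0. Qed.

Lemma green_ge0 r w : 0 < r -> 0 <= G r w.
Proof.
move=> r0; rewrite /green mulr_ge0 ?expR_ge0 // laplacianE.
exact: (network_inv_ge0 (conductance_sym _) (conductance_ge0 _) (conductance_conn _)
  (pin_ge0 _ r0) (pin_gt0 _ r0)).
Qed.

(** By symmetry of the inverse, the bound of [network_inv_d_le1] applies with
    the ground conductance at x. *)
Lemma green_bound r w : 0 < r -> r * G r w <= expR (coord w.1.1 (Some y)) / q x.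
Proof.
move=> r0; rewrite /green laplacianE; set t := w.1.1.
set c := conductance _; set d := fun i => _.
pose tau i := coord t (Some i).
have h := network_inv_d_le1 (conductance_sym tau) (conductance_ge0 tau)
  (conductance_conn tau)
  (pin_ge0 t r0) (pin_gt0 t r0) (enum_rank y) k.
rewrite (network_inv_sym (conductance_sym tau)) -/c in h.
rewrite expRD ler_pdivlMr //.
have -> : r * (expR (coord t (Some x)) * expR (coord t (Some y)) *
    invmx (network_mx c d) k (enum_rank y)) * q x =
  expR (coord t (Some y)) * (invmx (network_mx c d) k (enum_rank y) * d k).
  by rewrite /d enum_rankK; ring.
by rewrite -[leRHS]mulr1 ler_wpM2l ?expR_ge0.
Qed.

Lemma measurable_green r : 0 < r -> measurable_fun setT (G r).
Proof.
move=> r0.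
have mt i : measurable_fun setT (fun w : config R e => coord w.1.1 i).
  apply: (measurableT_comp (@measurable_coord R V i)).
  exact: (measurableT_comp (@measurable_fst _ _ _ _) (@measurable_fst _ _ _ _)).
have mexp i j : measurable_fun setT
  (fun w : config R e => expR (coord w.1.1 i + coord w.1.1 j)).
  by apply: measurableT_comp => //; exact: measurable_funD.
apply: measurable_funM; first exact: mexp.
apply: measurable_invmx => [i j|w]; last first.
  rewrite laplacianE; exact:
    (network_unit (conductance_sym _) (conductance_ge0 _) (conductance_conn _)
    (pin_ge0 _ r0) (pin_gt0 _ r0)).
have mcond a b : measurable_fun setT (fun w : config R e =>
    beta a b * expR (coord w.1.1 (Some a) + coord w.1.1 (Some b))).
  by apply: measurable_funM => //; exact: mexp.
under eq_fun do rewrite !mxE.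
apply: measurable_funD.
  cbv zeta; case: (enum_val i == enum_val j);
    first under eq_fun do rewrite /= big_mkcond.
    by apply: measurable_sum => l; case: (e l (enum_val i)) => //; exact: mcond.
  by case: (e (enum_val i) (enum_val j)) => //; apply: measurable_funN;
    exact: mcond.
case: (i == j); last first.
  by under eq_fun do rewrite mulr0n; exact: measurable_cst.
under eq_fun do rewrite mulr1n.
by apply: measurable_funM => //; apply: measurableT_comp => //; exact: mt.
Qed.

(** Seen from the zoomed coordinates, the conductances are multiplied by (h /
    r)^2, with h the height, while the grounding does not depend on r and has
    sum h times mass. *)
Lemma cvg_green z (T : tree) :
  r * (r * G r (zoom r z, T)) @[r --> 0^'+] -->
    ht z * (expR (rc z.1 y) / mass x q z.1).
Proof.
have h0 : 0 < ht z by exact: height_gt0.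
have m0 : 0 < mass x q z.1 by exact: mass_gt0.
set h := ht z in h0 *; set m := mass x q z.1 in m0 *.
pose c := conductance (rc z.1).
pose d (i : 'I_N) := q (enum_val i) * (h * expR (rc z.1 (enum_val i))).
have d0 i : 0 <= d i by rewrite mulr_ge0 // mulr_ge0 ?expR_ge0 // ltW.
have dk : 0 < d k by rewrite /d enum_rankK mulr_gt0 // mulr_gt0 ?expR_gt0.
have dsum : \sum_i d i = h * m.
  rewrite /d -(sum_enum_val (fun i => q i * (h * expR (rc z.1 i)))) /m /mass
    mulr_sumr.
  by apply: eq_bigr => i _; ring.
have [C hC] := network_inv_limit (enum_rank y) (conductance_sym (rc z.1))
  (conductance_ge0 _) (conductance_conn _) d0 dk.
pose g r := invmx (network_mx (fun i j => (h / r) ^+ 2 * c i j) d) k (enum_rank y).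
have GE r : 0 < r -> r * (r * G r (zoom r z, T)) =
  h * (expR (rc z.1 y) / m) * (g r * (h * m)).
  move=> r0; rewrite /green laplacianE /=.
  have -> : network_mx (conductance (fun i => coord (zoom r z).1 (Some i)))
    (fun i => q (enum_val i) * r * expR (coord (zoom r z).1 (Some (enum_val i)))) =
    network_mx (fun i j => (h / r) ^+ 2 * c i j) d.
    congr network_mx.
      apply/funext => i; apply/funext => j; rewrite /c /conductance.
      case: ifP; rewrite ?mulr0 // => _; rewrite !expRD !expR_zoom1 // -/h.
      by field; rewrite gt_eqF.
    by apply/funext => i; rewrite /d expR_zoom1 // -/h; field; rewrite gt_eqF.
  rewrite -/(g r) expRD !expR_zoom1 // -/h rel_coordx expR0.
  by field; rewrite !gt_eqF.
have key : g r * (h * m) @[r --> 0^'+] --> (1 : R).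
  apply/subr_cvg0; apply: norm_cvg0.
  apply: (@squeeze_cvgr _ _ _ _ (fun=> 0) (fun r => r ^+ 2 * (C / h ^+ 2)));
    last 2 first.
  - exact: cvg_cst.
  - have cont : {for 0, continuous (fun r : R => r ^+ 2 * (C / h ^+ 2))}.
      by apply: continuousM; [exact: exprn_continuous|exact: cst_continuous].
    by have := cvg_at_right_filter cont; rewrite expr0n mul0r.
  near=> r; have r0 : 0 < r by [].
  rewrite normr_ge0 /=; have hr : 0 < (h / r) ^+ 2 by rewrite exprn_gt0 // divr_gt0.
  have := hC _ hr; rewrite dsum -/(g r) => /le_trans; apply.
  by rewrite le_eqVlt; apply/orP; left; apply/eqP; field; rewrite !gt_eqF.
rewrite -[X in _ --> X]mulr1.
apply: (@cvg_trans _ ((fun r => h * (expR (rc z.1 y) / m) * (g r * (h * m))) @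
  0^'+)).
  by apply: near_eq_cvg; near=> r; rewrite GE.
by apply: cvgM; [exact: cvg_cst|exact: key].
Unshelve. all: by end_near. Qed.

End green_function.

(** * The two limits and their comparison *)

Section limits.
Variables (R : realType) (V : finType) (e : rel V) (beta : V -> V -> R).
Hypotheses (es : symmetric e) (ei : irreflexive e).
Hypotheses (econn : connected_graph e) (b0 : forall i j, e i j -> 0 < beta i j).
Hypothesis bs : forall i j, e i j -> beta i j = beta j i.
Local Notation RV := (RV R V).
Local Notation tree := (spanning_tree e).
Local Notation N := #|V|.
Local Notation lam2 := (@lebesgue_tuple R N \x @lebesgue_tuple R N)%E.

Section green_limit.
Variables (x y : V) (p : V -> R).
Hypotheses (p0 : forall i, 0 <= p i) (px : 0 < p x).

Definition green_profile (z : RV * RV) (T : tree) : R :=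
  expR (rel_coord x z.1 y) / mass x p z.1.

Lemma green_limit :
  (lam2.-integrable setT (fun z =>
    (\sum_T limit_integrand beta x p green_profile z T)%:E)) /\
  (r%:E * expect beta (fun i => p i * r)%R
    (@green R V e beta (fun i => p i * r)%R x y))%E
    @[r --> 0^'+] --> (\int[lam2]_z
      (\sum_T limit_integrand beta x p green_profile z T)%:E)%E.
Proof.
pose f r (w : config R e) := r * @green R V e beta (fun i => p i * r) x y w.
have mG r (r0 : 0 < r) := measurable_green es ei econn b0 bs p0 px y r0.
have mf r : 0 < r -> measurable_fun setT (f r).
  by move=> r0; apply: measurable_funM => //; exact: mG.
have fb r w : 0 < r -> 0 <= f r w <= expR (coord w.1.1 (Some y)) / p x.
  move=> r0; rewrite mulr_ge0 ?(ltW r0) ?(green_ge0 es ei econn b0 bs p0 px) //=.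
  exact: (green_bound es ei econn b0 bs p0 px).
have fl z T : r * f r (zoom x p r z, T) @[r --> 0^'+] -->
  height x p z * green_profile z T.
  exact: (cvg_green es ei econn b0 bs p0 px).
have [ig cvg] := scaling_limit es ei econn b0 p0 px mf fb fl.
split; first exact: ig.
apply: cvg_trans cvg; apply: near_eq_cvg; near=> r.
have r0 : 0 < r by [].
have eps0 i : 0 <= p i * r by rewrite mulr_ge0 // ltW.
have G0 w : 0 <= @green R V e beta (fun i => p i * r) x y w.
  exact: (green_ge0 es ei econn b0 bs p0 px).
have f0 w : 0 <= f r w by rewrite mulr_ge0 // ltW.
rewrite (expectE es b0 eps0 (mf r r0) f0) (expectE es b0 eps0 (mG r r0) G0).
have mGd : measurable_fun setT
  (fun w => @green R V e beta (fun i => p i * r) x y w *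
    density beta (fun i => p i * r) w).
  by apply: measurable_funM; [exact: mG|exact: measurable_density].
have msum : measurable_fun setT
  (fun z => (\sum_T @green R V e beta (fun i => p i * r) x y (z, T) *
    density beta (fun i => p i * r) (z, T))%:E).
  apply/measurable_EFinP; apply: measurable_sum => T.
  exact: (measurable_tree_section T mGd).
have E := ge0_integralZl_EFin lam2 measurableT _ msum (ltW r0).
rewrite -E => [|z _]; last first.
  by rewrite lee_fin; apply: sumr_ge0 => T _; rewrite mulr_ge0 // density_ge0.
apply: eq_integral => z _; rewrite -EFinM; congr EFin.
by rewrite mulr_sumr; apply: eq_bigr => T _; rewrite /f -mulrA.
Unshelve. all: by end_near. Qed.

End green_limit.

Section tree_limit.
Variables (x y : V) (p : V -> R).
Hypotheses (px : 0 < p x) (py : 0 < p y).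

Definition rooted_conn (T : tree) : R :=
  (adj (val T) (Some x) None && tree_conn T x y)%:R.

Definition tree_profile (z : RV * RV) (T : tree) : R :=
  expR (rel_coord x z.1 y) / (p x + p y * expR (rel_coord x z.1 y)) * rooted_conn T.

Local Notation q := (pin1 (p x) x).

Lemma pin1_ge0 i : 0 <= q i.
Proof. by rewrite /pin1; case: ifP => // _; exact: ltW. Qed.

Lemma pin1_x : q x = p x. Proof. by rewrite /pin1 eqxx. Qed.

Lemma mass_pin1 v : mass x q v = p x.
Proof.
rewrite /mass (bigD1 x) //= rel_coordx expR0 mulr1 pin1_x big1 ?addr0 // => i ix.
by rewrite /pin1 (negbTE ix) mul0r.
Qed.

(** In the zoomed coordinates r times the observable does not depend on r. *)
Lemma observable_limit :
  (lam2.-integrable setT (fun z =>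
    (\sum_T limit_integrand beta x q tree_profile z T)%:E)) /\
  expect beta (pin1 (p x * r) x) (@observable R V e p x y)
    @[r --> 0^'+] --> (\int[lam2]_z
      (\sum_T limit_integrand beta x q tree_profile z T)%:E)%E.
Proof.
have qx : 0 < q x by rewrite pin1_x.
have den0 (u w : R) : 0 < p x * expR u + p y * expR w.
  by rewrite addr_gt0 // mulr_gt0 // expR_gt0.
have mf (r : R) : 0 < r -> measurable_fun setT (@observable R V e p x y).
  move=> _; apply: measurable_tree_sections => T.
  have mt' i : measurable_fun setT (fun z : RV * RV => coord z.1 i).
    exact: (measurableT_comp (@measurable_coord R V i) (@measurable_fst _ _ _ _)).
  rewrite /observable /=; apply: measurable_funM => //; apply: measurable_funM.
    by apply: measurableT_comp => //; apply: measurable_funD;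
      [exact: (mt' (Some x))|exact: (mt' (Some y))].
  apply: measurable_funV; apply: measurable_funD; apply: measurable_funM => //.
    by apply: measurableT_comp => //; exact: (mt' (Some x)).
  by apply: measurableT_comp => //; exact: (mt' (Some y)).
have fb (r : R) w : 0 < r ->
  0 <= @observable R V e p x y w <= expR (coord w.1.1 (Some y)) / q x.
  move=> _; rewrite /observable /= pin1_x.
  set a := tnth _ _; set b := tnth _ _.
  set ind := adj _ _ _ && tree_conn _ _ _.
  have i0 : 0 <= ind%:R :> R by rewrite ler0n.
  have i1 : ind%:R <= 1 :> R by rewrite -[leRHS]/(1%:R) ler_nat leq_b1.
  have q0 : 0 <= expR (a + b) / (p x * expR a + p y * expR b).
    by rewrite divr_ge0 ?expR_ge0 // ltW.
  rewrite mulr_ge0 //=; apply: (le_trans (ler_piMr q0 i1)).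
  rewrite ler_pdivrMr // mulrAC ler_pdivlMr // expRD.
  rewrite -subr_ge0 (_ : _ - _ = p y * expR b ^+ 2); last by ring.
  by rewrite mulr_ge0 ?sqr_ge0 // ltW.
have fl z T : r * @observable R V e p x y (zoom x q r z, T) @[r --> 0^'+] -->
    height x q z * tree_profile z T.
  apply: (@cvg_trans _ ((fun _ : R => height x q z * tree_profile z T) @ 0^'+));
    last exact: cvg_cst.
  apply: near_eq_cvg; near=> r; have r0 : 0 < r by [].
  have h0 : 0 < height x q z := height_gt0 pin1_ge0 qx z.
  rewrite /observable /= -/(coord (zoom x q r z).1 (Some x))
    -/(coord (zoom x q r z).1 (Some y)).
  rewrite expRD !(expR_zoom1 pin1_ge0 qx) // rel_coordx expR0 /tree_profile
    /rooted_conn.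
  set E := expR _; have E0 : 0 < E by exact: expR_gt0.
  have d0 : 0 < p x + p y * E by rewrite addr_gt0 // mulr_gt0.
  have d1 : 0 < p x * height x q z + p y * (height x q z * E).
    by apply: addr_gt0; [exact: mulr_gt0|exact: (mulr_gt0 py (mulr_gt0 h0 E0))].
  by field; rewrite (gt_eqF r0) (gt_eqF d1) (gt_eqF d0).
have [ig cvg] := scaling_limit es ei econn b0 pin1_ge0 qx mf fb fl.
split; first exact: ig.
have pinE r : pin1 (p x * r) x = (fun i => q i * r).
  by apply/funext => i; rewrite /pin1; case: ifP => // _; rewrite mul0r.
by apply: cvg_trans cvg; apply: near_eq_cvg; near=> r; rewrite pinE.
Unshelve. all: by end_near. Qed.

End tree_limit.

Section comparison.
Variables (x y : V) (p : V -> R).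
Hypotheses (xy : x != y) (p0 : forall i, 0 <= p i) (px : 0 < p x) (py : 0 < p y).

Lemma base_gt0 z : 0 < base e beta x z.
Proof.
apply: mulr_gt0; apply: prodr_gt0 => i _; last exact: expR_gt0.
by rewrite divr_gt0 ?expR_gt0 // mulr_gt0 // pi_gt0.
Qed.

Lemma inner_weight_gt0 (T : tree) v : 0 < inner_weight beta x T v.
Proof.
apply: prodr_gt0 => i /andP[_ /(adj_ext es)] /b0 h.
by rewrite mulr_gt0 ?expR_gt0.
Qed.

Lemma inner_weight_reroot r (T : tree) v : rooted r T ->
  inner_weight beta x (reroot x T) v = inner_weight beta x T v.
Proof. by move=> rT; apply: eq_bigl => pr; exact: (inner_edge_reroot es x rT). Qed.

Lemma tree_weight_rooted q r (T : tree) v : rooted r T ->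
  tree_weight beta x q T v = q r * expR (rel_coord x v r) * inner_weight beta x T v.
Proof.
by move=> /rootedP rT; congr (_ * _); rewrite (big_pred1 r).
Qed.

Definition rooted_sum (v : RV) : R :=
  \sum_(T : tree | rooted x T) inner_weight beta x T v.

(** Rerooting at x is injective on the trees attached at r and does not change
    the inner weight. *)
Lemma rooted_sum_le r v :
  \sum_(T : tree | rooted r T) inner_weight beta x T v <= rooted_sum v.
Proof.
rewrite (eq_bigr (fun T => inner_weight beta x (reroot x T) v)); last first.
  by move=> T rT; rewrite (inner_weight_reroot _ rT).
rewrite -(big_imset (fun T => inner_weight beta x T v)
  (reroot_inj es ei (x := x) (r := r))) /=.
rewrite /rooted_sum [leLHS]big_mkcond [leRHS]big_mkcond; apply: ler_sum => T _.
case: imsetP => [[U rU ->]|_].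
  by rewrite (rooted_reroot es x rU).
by case: ifP => // _; exact/ltW/inner_weight_gt0.
Qed.

Lemma tree_weight_ge0 q (T : tree) v : (forall i, 0 <= q i) ->
  0 <= tree_weight beta x q T v.
Proof.
move=> q0; apply: mulr_ge0; last exact/ltW/inner_weight_gt0.
by apply: prodr_ge0 => i _; rewrite mulr_ge0 ?expR_ge0.
Qed.

(** Trees with one edge at rho are classified by its end r; the weight of that
    edge factors out and rerooting at x bounds the rest. *)
Lemma tree_weight_sum_le v :
  \sum_(T : tree) tree_weight beta x p T v * (#|rho_nbr (val T)| == 1%N)%:R <=
  mass x p v * rooted_sum v.
Proof.
rewrite /mass mulr_suml.
apply: (@le_trans _ _ (\sum_r \sum_(T : tree | rooted r T) tree_weight beta x p T
  v)); last first.
  apply: ler_sum => r _.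
  rewrite (eq_bigr (fun T =>
    p r * expR (rel_coord x v r) * inner_weight beta x T v)); last first.
    by move=> T rT; rewrite (tree_weight_rooted _ _ rT).
  by rewrite -mulr_sumr ler_wpM2l ?rooted_sum_le // mulr_ge0 ?expR_ge0.
rewrite (exchange_big_dep xpredT) //=; apply: ler_sum => T _.
have tw0 := tree_weight_ge0 T v p0.
rewrite card_rho_nbr_eq1; case: existsP => [[r rT]|_]; last first.
  by rewrite mulr0; apply: sumr_ge0.
by rewrite mulr1 (bigD1 r) //= lerDl; apply: sumr_ge0.
Qed.

Lemma green_profile_gt0 z T : 0 < green_profile x y p z T.
Proof. by rewrite divr_gt0 ?expR_gt0 // mass_gt0. Qed.

Lemma limit_integrand_ge0 q psi z (T : tree) : (forall i, 0 <= q i) -> 0 < q x ->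
  0 <= psi z T -> 0 <= limit_integrand beta x q psi z T.
Proof.
move=> q0 qx psi0; have hz := ltW (height_gt0 q0 qx z).
exact: (mulr_ge0 (mulr_ge0 (mulr_ge0 (mulr_ge0 (ltW (base_gt0 z)) (expR_ge0 _))
  (tree_weight_ge0 _ _ q0)) (ler0n _ _)) (mulr_ge0 hz psi0)).
Qed.

Lemma green_sum_gt0 z : 0 < \sum_T limit_integrand beta x p (green_profile x y p) z
  T.
Proof.
have [T rT] := exists_rooted es x econn.
rewrite (bigD1 T) //= ltr_wpDr //.
  apply: sumr_ge0 => U _; apply: limit_integrand_ge0 => //;
    exact/ltW/green_profile_gt0.
rewrite /limit_integrand (tree_weight_rooted _ _ rT).
have -> : #|rho_nbr (val T)| == 1%N by rewrite card_rho_nbr_eq1; apply/existsP;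
  exists x.
have tw : 0 < p x * expR (rel_coord x z.1 x) * inner_weight beta x T z.1.
  by rewrite !mulr_gt0 ?expR_gt0 ?inner_weight_gt0.
exact: (mulr_gt0 (mulr_gt0 (mulr_gt0 (mulr_gt0 (base_gt0 z) (expR_gt0 _)) tw) ltr01)
  (mulr_gt0 (height_gt0 p0 px z) (green_profile_gt0 z T))).
Qed.

(** After the tree sums have been compared, what is left is that the mass is
    at least the sum of its terms at x and y; on the right all trees attached
    to rho at x alone contribute, since x and y are connected in them without
    rho. *)
Lemma limit_comparison z :
  \sum_T limit_integrand beta x p (green_profile x y p) z T <=
  \sum_T limit_integrand beta x (pin1 (p x) x) (tree_profile x y p) z T.
Proof.
set u := expR (tnth z.1 (enum_rank x)); set c := 1 + tnth z.2 (enum_rank x) ^+ 2.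
set E := expR (rel_coord x z.1 y); set B0 := base e beta x z * expR (- (u / 2)).
have c0 : 0 < c by exact: oneD_gt0.
have E0 : 0 < E by exact: expR_gt0.
have u0 : 0 < u by exact: expR_gt0.
have B00 : 0 < B0 by rewrite mulr_gt0 ?base_gt0 ?expR_gt0.
have m0 : 0 < mass x p z.1 by exact: mass_gt0.
have D0 : 0 <= rooted_sum z.1 by apply: sumr_ge0 => T _; exact/ltW/inner_weight_gt0.
have dE : 0 < p x + p y * E by rewrite addr_gt0 // mulr_gt0.
apply: (@le_trans _ _ (B0 * (u / c * (E / mass x p z.1)) * rooted_sum z.1)).
  rewrite (eq_bigr (fun T : tree => B0 * (height x p z * (E / mass x p z.1)) *
     (tree_weight beta x p T z.1 * (#|rho_nbr (val T)| == 1%N)%:R))); last first.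
    by move=> T _; rewrite /limit_integrand /green_profile -/u -/B0 -/E; ring.
  rewrite -mulr_sumr.
  have -> : B0 * (u / c * (E / mass x p z.1)) * rooted_sum z.1 =
      B0 * (height x p z * (E / mass x p z.1)) * (mass x p z.1 * rooted_sum z.1).
    by rewrite /height -/u -/c; field; rewrite !gt_eqF.
  rewrite ler_wpM2l ?tree_weight_sum_le // mulr_ge0 ?(ltW B00) // mulr_ge0 //.
    exact/ltW/height_gt0.
  by rewrite divr_ge0 // ltW.
apply: (@le_trans _ _ (B0 * (u / c * (E / (p x + p y * E))) * rooted_sum z.1)).
  have uc0 : 0 <= u / c by rewrite divr_ge0 // ltW.
  rewrite ler_wpM2r // (ler_wpM2l (ltW B00)) // (ler_wpM2l uc0) //.
  rewrite ler_pM2l // lef_pV2 ?posrE // /mass (bigD1 x) //= rel_coordx expR0 mulr1.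
  rewrite lerD2l (bigD1 y) /=; last by rewrite eq_sym.
  by rewrite lerDl; apply: sumr_ge0 => i _; rewrite mulr_ge0 ?expR_ge0.
rewrite [leRHS](bigID (rooted x)) /= ler_wpDr //.
  apply: sumr_ge0 => T _; apply: limit_integrand_ge0; rewrite ?pin1_x //.
    exact: pin1_ge0.
  by rewrite mulr_ge0 // divr_ge0 // ltW.
rewrite /rooted_sum mulr_sumr le_eqVlt; apply/orP; left; apply/eqP.
apply: eq_bigr => T rT; rewrite /limit_integrand (tree_weight_rooted _ _ rT)
  rel_coordx expR0 pin1_x.
have -> : #|rho_nbr (val T)| == 1%N by rewrite card_rho_nbr_eq1; apply/existsP;
  exists x.
rewrite /tree_profile /rooted_conn (tree_conn_rooted x y rT).
have /rootedP/(_ x) := rT; rewrite eqxx /rho_nbr /= => -> /=.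
rewrite /height mass_pin1 -/u -/c -/E -/B0.
by field; rewrite !gt_eqF.
Qed.

End comparison.

End limits.

(** * The theorem *)

Theorem theorem2p2 (R : realType) (V : finType) (e : rel V)
    (beta : V -> V -> R) (x y : V) (p : V -> R) :
  symmetric e -> irreflexive e -> connected_graph e ->
  (forall i j : V, e i j -> beta i j = beta j i) ->
  (forall i j : V, e i j -> 0 < beta i j) ->
  x != y ->
  (forall i : V, 0 <= p i) -> 0 < p x -> 0 < p y ->
  let eps (r : R) : V -> R := fun i => p i * r in
  let green_term (r : R) : \bar R :=
    (r%:E * expect beta (eps r) (@green R V e beta (eps r) x y))%E in
  let tree_term (r : R) : \bar R :=
    (expect beta (pin1 (eps r x) x) (@observable R V e p x y) +
     expect beta (pin1 (eps r y) y) (@observable R V e p y x))%E in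
  [/\ cvg (green_term r @[r --> 0^'+]),
      cvg (tree_term r @[r --> 0^'+]),
      (0 < lim (green_term r @[r --> 0^'+]))%E,
      (lim (green_term r @[r --> 0^'+]) <= lim (tree_term r @[r --> 0^'+]))%E &
      (lim (tree_term r @[r --> 0^'+]) < +oo)%E].
Proof.
move=> es ei econn bs b0 xy p0 px py eps green_term tree_term.
have [ig cg] := green_limit es ei econn b0 bs y p0 px.
have [ix cx] := observable_limit es ei econn b0 (x := x) (y := y) px py.
have [iy cy] := observable_limit es ei econn b0 (x := y) (y := x) py px.
set Lg := (\int[_]_z _)%E in cg; set Lx := (\int[_]_z _)%E in cx.
set Ly := (\int[_]_z _)%E in cy.
have fx : Lx \is a fin_num by exact: (integrable_fin_num measurableT ix).
have fy : Ly \is a fin_num by exact: (integrable_fin_num measurableT iy).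
have ct : tree_term r @[r --> 0^'+] --> (Lx + Ly)%E.
  by apply: cvgeD => //; rewrite fin_num_adde_defl.
have Ly0 : (0 <= Ly)%E.
  apply: integral_ge0 => z _; rewrite lee_fin; apply: sumr_ge0 => T _.
  apply: limit_integrand_ge0; rewrite ?pin1_x //; first exact: pin1_ge0.
  by rewrite mulr_ge0 // divr_ge0 ?expR_ge0 // addr_ge0 ?mulr_ge0 ?expR_ge0 // ltW.
have Lg0 : (0 < Lg)%E.
  have mg := measurable_int _ ig.
  apply: integral_lam2_gt0; first exact/measurable_EFinP.
  by move=> z; exact: green_sum_gt0.
have Lgx : (Lg <= Lx)%E.
  apply: ge0_le_integral => //.
  - by move=> z _; rewrite lee_fin ltW // green_sum_gt0.
  - exact: measurable_int ig.
  - exact: measurable_int ix.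
  - by move=> z _; rewrite lee_fin limit_comparison.
rewrite (cvg_lim _ cg) // (cvg_lim _ ct) //; split => //.
- by rewrite (le_trans Lgx) // leeDl.
- by rewrite ltey_eq fin_numD fx fy.
Qed.
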